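(* Let $(M,F)$ be an $n$-dimensional complex Finsler space. The following assertions are equivalent: i) $(M,F)$ is a complex Landsberg space, i.e. $\overset{B}{L}{}^i_{jk}=\overset{c}{L}{}^i_{jk}$; ii) $C_{l\bar r h\overset{B}{|}0}=0$; iii) $2(\dot\partial_h \overset{B}{L}{}^i_{jk})g_{i\bar r}-\overset{B}{L}{}^{\bar m}_{\bar r k}C_{j\bar m h}-\overset{B}{L}{}^{\bar m}_{\bar r j}C_{k\bar m h}=C_{j\bar r h\overset{B}{|}k}+C_{k\bar r h\overset{B}{|}j}$; iv) $g_{i\bar j\overset{B}{|}k}=\big(\overset{c}{L}{}^{\bar m}_{\bar j k}-\overset{B}{L}{}^{\bar m}_{\bar j k}\big)g_{i\bar m}$. (All identities are required for all values of the free indices and at all points of $\widetilde{T'M}$.)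
   Context: Let $M$ be an $n$-dimensional complex manifold, $T'M$ its holomorphic tangent bundle with local coordinates $(z^k,\eta^k)$, and $\widetilde{T'M}=T'M\setminus\{0\}$ (zero section removed). A complex Finsler space $(M,F)$ is given by a continuous $F:T'M\to[0,\infty)$ with: $L:=F^2$ smooth on $\widetilde{T'M}$; $F(z,\eta)=0$ iff $\eta=0$; $F(z,\lambda\eta)=|\lambda|F(z,\eta)$ for $\lambda\in\mathbb C$; and the Hermitian matrix $g_{i\bar j}:=\partial^2L/\partial\eta^i\partial\bar\eta^j$ positive definite. $(g^{\bar j i})$ is the inverse matrix, $g^{\bar j i}g_{k\bar j}=\delta^i_k$. Notation: $\dot\partial_k=\partial/\partial\eta^k$, $\dot\partial_{\bar k}=\partial/\partial\bar\eta^k$; summation convention. Cartan tensors: $C_{i\bar jk}=\dot\partial_kg_{i\bar j}$, $C_{i\bar j\bar k}=\dot\partial_{\bar k}g_{i\bar j}$. Set $N^i_j:=g^{\bar mi}\frac{\partial g_{l\bar m}}{\partial z^j}\eta^l$, spray coefficients $G^i:=\tfrac12N^i_j\eta^j$, $\overset{c}{N}{}^i_j:=\dot\partial_jG^i$, $\overset{c}{\delta}_k:=\frac{\partial}{\partial z^k}-\overset{c}{N}{}^j_k\dot\partial_j$, and $\overset{c}{\delta}_{\bar k}$ its conjugate. Berwald coefficients: $\overset{B}{L}{}^i_{jk}:=\dot\partial_k\overset{c}{N}{}^i_j$, $\overset{B}{L}{}^i_{j\bar k}:=\dot\partial_{\bar k}\overset{c}{N}{}^i_j$. Rund coefficients: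 $\overset{c}{L}{}^i_{jk}:=\tfrac12g^{\bar li}(\overset{c}{\delta}_kg_{j\bar l}+\overset{c}{\delta}_jg_{k\bar l})$, $\overset{c}{L}{}^i_{j\bar k}:=\tfrac12g^{\bar li}(\overset{c}{\delta}_{\bar k}g_{j\bar l}-\overset{c}{\delta}_{\bar l}g_{j\bar k})$. Barred-index coefficients are conjugates: $L^{\bar\imath}_{\bar jk}=\overline{L^i_{j\bar k}}$, $L^{\bar\imath}_{\bar j\bar k}=\overline{L^i_{jk}}$. The $h$-covariant derivative with respect to the Berwald connection, $\overset{B}{|}k$, of a tensor with lower indices applies $\overset{c}{\delta}_k$ and subtracts a term $\overset{B}{L}{}^l_{ik}$ for each unbarred lower index $i$ and $\overset{B}{L}{}^{\bar m}_{\bar jk}$ for each barred lower index $\bar j$; e.g. $g_{i\bar j\overset{B}{|}k}=\overset{c}{\delta}_kg_{i\bar j}-\overset{B}{L}{}^l_{ik}g_{l\bar j}-\overset{B}{L}{}^{\bar m}_{\bar jk}g_{i\bar m}$. An index $0$ means contraction with $\eta$: $C_{l\bar rh\overset{B}{|}0}=C_{l\bar rh\overset{B}{|}k}\eta^k$. *)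

(* Defs.v *)
From HB Require Import structures.
From mathcomp Require Import all_boot all_order all_algebra.
From mathcomp Require Import all_classical all_reals all_analysis.
From mathcomp Require Import complex.
Set Implicit Arguments. Unset Strict Implicit. Unset Printing Implicit Defensive.
Import Order.TTheory GRing.Theory Num.Theory.
Import numFieldNormedType.Exports.
Local Open Scope classical_set_scope.
Local Open Scope ring_scope.
Local Open Scope complex_scope.

(* The metric topology is attached to R^o for every numFieldType R; transfer it
   to the concrete type R[i]. *)
#[warnings="-redundant-canonical-projection"]
HB.instance Definition _ (R : realType) := PseudoPointedMetric.copy R[i] (R[i])^o.
#[warnings="-redundant-canonical-projection"]
HB.instance Definition _ (R : realType) := GRing.ComAlgebra.copy R[i] (R[i])^o.
#[warnings="-redundant-canonical-projection"]
HB.instance Definition _ (R : realType) := Vector.copy R[i] (R[i])^o.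
#[warnings="-redundant-canonical-projection"]
HB.instance Definition _ (R : realType) := NormedModule.copy R[i] (R[i])^o.

Record chart (R : realType) (n : nat) (M : topologicalType) := Chart {
  chart_dom : set M;
  chart_fun : M -> 'rV[R[i]]_n;
  chart_inv : 'rV[R[i]]_n -> M;
  chart_dom_open : open chart_dom;
  chart_im_open : open (chart_fun @` chart_dom);
  chart_funK : forall p, chart_dom p -> chart_inv (chart_fun p) = p;
  chart_fun_cont : forall p, chart_dom p -> {for p, continuous chart_fun};
  chart_inv_cont : forall z, (chart_fun @` chart_dom) z ->
    {for z, continuous chart_inv} }.

Section Charts.
Context {R : realType} {n : nat} {M : topologicalType}.
Implicit Types c d : chart R n M.

Definition chart_im c : set 'rV[R[i]]_n := chart_fun c @` chart_dom c.

Definition chart_trans c d : 'rV[R[i]]_n -> 'rV[R[i]]_n :=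
  chart_fun d \o chart_inv c.

(* Differentiability is over the field R[i]; complex differentiability at every
   point of an open set is holomorphy. *)
Definition holo_trans c d :=
  forall p, chart_dom c p -> chart_dom d p ->
    differentiable (chart_trans c d) (chart_fun c p).

Definition chart_compat c d := holo_trans c d /\ holo_trans d c.

End Charts.

Record complex_manifold (R : realType) (n : nat) := ComplexManifold {
  carrier :> topologicalType;
  manifold_hausdorff : hausdorff_space carrier;
  manifold_second_countable : @second_countable carrier;
  atlas : set (chart R n carrier);
  atlas_cover : forall p, exists2 c, atlas c & chart_dom c p;
  atlas_compat : forall c d, atlas c -> atlas d -> chart_compat c d;
  atlas_max : forall c, (forall d, atlas d -> chart_compat c d) -> atlas c }.

Section TangentBundle.
Context {R : realType} {n : nat} (M : complex_manifold R n).
Implicit Types (p : M) (c d e : chart R n M).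

Definition chart_at p : set (chart R n M) := [set c | atlas c /\ chart_dom c p].

(* A holomorphic tangent vector at p is its family of components in all the
   charts at p, related by the differentials of the transition maps; the
   components in the other charts are irrelevant and normalized to 0, so that
   equality of tangent vectors is equality of components. *)
Record tangent p := Tangent {
  tangent_comp : chart R n M -> 'rV[R[i]]_n;
  tangent_compat : forall c d, chart_at p c -> chart_at p d ->
    tangent_comp d = 'd (chart_trans c d) (chart_fun c p) (tangent_comp c);
  tangent_out : forall c, ~ chart_at p c -> tangent_comp c = 0 }.

Definition tangent_bundle := {p : M & tangent p}.

Lemma chart_trans_fun p c d : chart_dom c p ->
  chart_trans c d (chart_fun c p) = chart_fun d p.
Proof. by move=> cp; rewrite /chart_trans /= chart_funK. Qed.

Lemma diff_chart_trans p c d : chart_at p c -> chart_at p d ->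
  differentiable (chart_trans c d) (chart_fun c p).
Proof. by move=> [ca cp] [da dp]; exact: (atlas_compat ca da).1. Qed.

Lemma diff_chart_trans_comp p c d e (v : 'rV[R[i]]_n) :
    chart_at p c -> chart_at p d -> chart_at p e ->
  'd (chart_trans d e) (chart_fun d p) ('d (chart_trans c d) (chart_fun c p) v)
  = 'd (chart_trans c e) (chart_fun c p) v.
Proof.
move=> pc pd pe; have [ca cp] := pc; have [da dp] := pd.
have Dcd := diff_chart_trans pc pd; have Dde := diff_chart_trans pd pe.
rewrite -(chart_trans_fun d cp) in Dde *.
rewrite -[LHS]/((_ \o _) v) -(diff_comp Dcd Dde).
apply: etrans (esym (deriveE v (differentiable_comp Dcd Dde))) _.
apply: etrans (deriveE v (diff_chart_trans pc pe)).
apply: near_eq_derive.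
have cim : (chart_fun c @` chart_dom c) (chart_fun c p) by exists p.
have : \forall z \near chart_fun c p, chart_dom d (chart_inv c z).
  have := chart_inv_cont cim; rewrite /prop_for /continuous_at chart_funK//.
  by apply; apply: open_nbhs_nbhs; split=> //; exact: chart_dom_open.
by apply: filterS => z dz; rewrite /chart_trans /= chart_funK.
Qed.

Definition tangent_coord p c (eta : 'rV[R[i]]_n) d : 'rV[R[i]]_n :=
  if `[< chart_at p c /\ chart_at p d >]
  then 'd (chart_trans c d) (chart_fun c p) eta else 0.

Lemma tangent_coord_compat p c eta d e : chart_at p d -> chart_at p e ->
  tangent_coord p c eta e
  = 'd (chart_trans d e) (chart_fun d p) (tangent_coord p c eta d).
Proof.
move=> pd pe; rewrite /tangent_coord.
have [pc|npc] := pselect (chart_at p c).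
  by rewrite !asboolT//; exact/esym/diff_chart_trans_comp.
by rewrite !asboolF ?linear0//; case.
Qed.

Lemma tangent_coord_out p c eta d :
  ~ chart_at p d -> tangent_coord p c eta d = 0.
Proof. by move=> npd; rewrite /tangent_coord; case: asboolP => // -[]. Qed.

(* The tangent vector at p with components eta in the chart c. *)
Definition tangent_of p c eta : tangent p :=
  Tangent (@tangent_coord_compat p c eta) (@tangent_coord_out p c eta).

(* The point of the bundle with coordinates (z, eta) = q in the chart c. *)
Definition bundle_point c (q : 'rV[R[i]]_n * 'rV[R[i]]_n) : tangent_bundle :=
  existT tangent (chart_inv c q.1) (tangent_of (chart_inv c q.1) c q.2).

Lemma tangent_ofE p c eta : chart_at p c -> tangent_comp (tangent_of p c eta) c = eta.
Proof.
move=> pc /=; rewrite /tangent_coord asboolT//; have [_ cp] := pc.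
rewrite -deriveE; last exact: diff_chart_trans.
have -> : 'D_eta (chart_trans c c) (chart_fun c p) = 'D_eta id (chart_fun c p).
  apply: near_eq_derive.
  have := open_nbhs_nbhs (conj (@chart_im_open _ _ _ c) (imageP (chart_fun c) cp)).
  by apply: filterS => _ [p' cp' <-]; rewrite chart_trans_fun.
by rewrite derive_id.
Qed.

Lemma tangent_comp_inj p c (v w : tangent p) : chart_at p c ->
  tangent_comp v c = tangent_comp w c -> v = w.
Proof.
move=> pc; case: v => v vP v0; case: w => w wP w0 /= vw.
have E : v = w.
  apply/funext => d; have [pd|npd] := pselect (chart_at p d).
    by rewrite (vP _ _ pc pd) (wP _ _ pc pd) vw.
  by rewrite v0// w0.
by subst w; congr Tangent; exact: Prop_irrelevance.
Qed.

Lemma bundle_point_surj (p : M) (v : tangent p) c : chart_at p c ->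
  bundle_point c (chart_fun c p, tangent_comp v c) = existT tangent p v.
Proof.
move=> pc; rewrite /bundle_point /= chart_funK; last by case: pc.
by congr existT; apply: (tangent_comp_inj pc); exact: tangent_ofE.
Qed.

End TangentBundle.

Section WirtingerCalculus.
Context {R : realType} {n : nat}.
Local Notation V := 'rV[R[i]]_n.
Implicit Types (f : V * V -> R[i]) (q v : V * V) (D : set (V * V)).

Definition real_derivable f q v :=
  derivable (fun t : R => complex.Re (f (q + t%:C *: v))) 0 1 /\
  derivable (fun t : R => complex.Im (f (q + t%:C *: v))) 0 1.

Definition real_derive v f q : R[i] :=
  derive1 (fun t : R => complex.Re (f (q + t%:C *: v))) 0 +i*
  derive1 (fun t : R => complex.Im (f (q + t%:C *: v))) 0.

Fixpoint is_Ck (k : nat) D f : Prop :=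
  (forall q, D q -> {for q, continuous f}) /\
  if k is k'.+1 then forall v,
    (forall q, D q -> real_derivable f q v) /\ is_Ck k' D (real_derive v f)
  else True.

(* C^oo in the real sense, on the open set D. *)
Definition smooth_on D f := forall k, is_Ck k D f.

(* If v = (e_k, 0) = x^k-direction then 'i v is the y^k-direction, so that these
   are d/dz^k = (d/dx^k - i d/dy^k)/2 and d/dzbar^k = (d/dx^k + i d/dy^k)/2. *)
Definition wirt v f q : R[i] :=
  2^-1 * (real_derive v f q - 'i * real_derive ('i *: v) f q).
Definition wirt_bar v f q : R[i] :=
  2^-1 * (real_derive v f q + 'i * real_derive ('i *: v) f q).

Definition dz (k : 'I_n) := wirt (delta_mx 0 k, 0).
Definition dzb (k : 'I_n) := wirt_bar (delta_mx 0 k, 0).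
Definition deta (k : 'I_n) := wirt (0, delta_mx 0 k).
Definition detab (k : 'I_n) := wirt_bar (0, delta_mx 0 k).

End WirtingerCalculus.

(* The geometric objects attached to L = F^2 read in a chart, as functions of
   the bundle coordinates q = (z, eta).  Indices are listed in the order in
   which they are written, upper indices first; a suffix "b" on the name of an
   index marks a barred one, and the suffix "_b" of a coefficient means that its
   second lower index is barred. *)
Section LocalObjects.
Context {R : realType} {n : nat} (L : 'rV[R[i]]_n * 'rV[R[i]]_n -> R[i]).
Local Notation pt := ('rV[R[i]]_n * 'rV[R[i]]_n)%type.
Local Notation field := (pt -> R[i]).
Implicit Types (q : pt) (f : field).

Definition gfund (i jb : 'I_n) : field := deta i (detab jb L).

Definition gmx q : 'M[R[i]]_n := \matrix_(i, jb) gfund i jb q.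

(* g^{jb i}: row index barred, so that gmx q *m invmx (gmx q) = 1 reads
   g_{k jb} g^{jb i} = delta_k^i. *)
Definition ginv (jb i : 'I_n) : field := fun q => invmx (gmx q) jb i.

Definition cartan (i jb k : 'I_n) : field := deta k (gfund i jb).

Definition NCF (i j : 'I_n) : field := fun q =>
  \sum_(l < n) \sum_(mb < n) ginv mb i q * dz j (gfund l mb) q * q.2 0 l.

Definition spray (i : 'I_n) : field := fun q =>
  2^-1 * \sum_(j < n) NCF i j q * q.2 0 j.

Definition Nc (i j : 'I_n) : field := deta j (spray i).

Definition delta_c (k : 'I_n) f : field := fun q =>
  dz k f q - \sum_(j < n) Nc j k q * deta j f q.
Definition delta_cb (k : 'I_n) f : field := fun q =>
  dzb k f q - \sum_(j < n) (Nc j k q)^* * detab j f q.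

(* Berwald: L^i_{jk} and L^i_{j kb} *)
Definition LB (i j k : 'I_n) : field := deta k (Nc i j).
Definition LB_b (i j kb : 'I_n) : field := detab kb (Nc i j).

(* Rund: L^i_{jk} and L^i_{j kb} *)
Definition LR (i j k : 'I_n) : field := fun q =>
  2^-1 * \sum_(lb < n) ginv lb i q * (delta_c k (gfund j lb) q + delta_c j (gfund k lb) q).
Definition LR_b (i j kb : 'I_n) : field := fun q =>
  2^-1 * \sum_(lb < n)
    ginv lb i q * (delta_cb kb (gfund j lb) q - delta_cb lb (gfund j kb) q).

(* L^{ib}_{jb k}, the conjugates of the above. *)
Definition LB_bar (ib jb k : 'I_n) : field := fun q => (LB_b ib jb k q)^*.
Definition LR_bar (ib jb k : 'I_n) : field := fun q => (LR_b ib jb k q)^*.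

(* Berwald h-covariant derivatives T_{i jb | k} and T_{i jb h | k}. *)
Definition hcov2 (T : 'I_n -> 'I_n -> field) (i jb k : 'I_n) : field := fun q =>
  delta_c k (T i jb) q
  - \sum_(l < n) LB l i k q * T l jb q
  - \sum_(mb < n) LB_bar mb jb k q * T i mb q.
Definition hcov3 (T : 'I_n -> 'I_n -> 'I_n -> field) (i jb h k : 'I_n) : field :=
  fun q =>
  delta_c k (T i jb h) q
  - \sum_(l < n) LB l i k q * T l jb h q
  - \sum_(mb < n) LB_bar mb jb k q * T i mb h q
  - \sum_(l < n) LB l h k q * T i jb l q.

End LocalObjects.

Section Finsler.
Context {R : realType} {n : nat}.

(* The coordinates of the bundle over the domain of c, and of the slit bundle. *)
Definition bundle_dom (M : complex_manifold R n) (c : chart R n M) :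
    set ('rV[R[i]]_n * 'rV[R[i]]_n) := [set q | chart_im c q.1].
Definition slit_dom (M : complex_manifold R n) (c : chart R n M) :
    set ('rV[R[i]]_n * 'rV[R[i]]_n) := [set q | chart_im c q.1 /\ q.2 != 0].

Definition sqr_in_chart (M : complex_manifold R n) (F : tangent_bundle M -> R)
    (c : chart R n M) (q : 'rV[R[i]]_n * 'rV[R[i]]_n) : R[i] :=
  (F (bundle_point c q) ^+ 2)%:C.

(* Continuity and smoothness refer to the manifold structure of T'M, whose
   charts are the bundle charts. *)
Record finsler_metric (M : complex_manifold R n) := FinslerMetric {
  finsler_fun :> tangent_bundle M -> R;
  finsler_ge0 : forall v, 0 <= finsler_fun v;
  finsler_cont : forall c, atlas c -> forall q, bundle_dom c q ->
    {for q, continuous (fun q' => finsler_fun (bundle_point c q'))};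
  finsler_smooth : forall c, atlas c ->
    smooth_on (slit_dom c) (sqr_in_chart finsler_fun c);
  finsler_eq0 : forall c, atlas c -> forall q, bundle_dom c q ->
    finsler_fun (bundle_point c q) = 0 <-> q.2 = 0;
  finsler_homog : forall c, atlas c -> forall q (lambda : R[i]), bundle_dom c q ->
    (finsler_fun (bundle_point c (q.1, lambda *: q.2)))%:C
    = `|lambda| * (finsler_fun (bundle_point c q))%:C;
  (* For complex numbers, 0 < x means that x is real and positive. *)
  finsler_posdef : forall c, atlas c -> forall q, slit_dom c q ->
    forall v : 'rV[R[i]]_n, v != 0 ->
    0 < \sum_(i < n) \sum_(j < n)
          gfund (sqr_in_chart finsler_fun c) i j q * v 0 i * (v 0 j)^* }.

(* An identity between local objects required at every point of the slit
   tangent bundle, in all local coordinates. *)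
Definition on_slit_bundle (M : complex_manifold R n) (F : finsler_metric M)
    (P : ('rV[R[i]]_n * 'rV[R[i]]_n -> R[i]) -> 'rV[R[i]]_n * 'rV[R[i]]_n -> Prop) :=
  forall c : chart R n M, atlas c -> forall q, slit_dom c q ->
    P (sqr_in_chart F c) q.

Definition complex_landsberg (M : complex_manifold R n) (F : finsler_metric M) :=
  on_slit_bundle F (fun L q => forall i j k : 'I_n, LB L i j k q = LR L i j k q).

End Finsler.

(* Main.v *)
(* Since L is (1,1)-homogeneous, Euler's relations give g_{l mb} eta^l = detab_m L,
   and the spray is determined by 2 G^i g_{i mb} = eta^j d_{z^j} detab_m L.
   Differentiating this equation in eta^k and eta^h yields
     2 (LB - LR)^i_{kh} g_{i mb} = C_{k mb h | 0},
   hence i) <-> ii) pointwise.  Differentiating i), in the form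
   2 LB^i_{jk} g_{i rb} = delta_k g_{j rb} + delta_j g_{k rb}, in eta^h gives iii),
   and contracting iii) with eta^k gives back ii), as the remaining terms vanish by
   homogeneity.  Finally LR^{mb}_{jb k} g_{i mb} = (delta_k g_{i jb} - delta_i g_{k jb}) / 2
   turns iv) into LB^l_{ik} g_{l jb} = (delta_k g_{i jb} + delta_i g_{k jb}) / 2, which is i). *)
Require Import Defs.
From HB Require Import structures.
From mathcomp Require Import all_boot all_order all_algebra.
From mathcomp Require Import all_classical all_reals all_analysis.
From mathcomp Require Import complex.
From mathcomp Require Import ring lra.
Set Implicit Arguments. Unset Strict Implicit. Unset Printing Implicit Defensive.
Import Order.TTheory GRing.Theory Num.Theory.
Import numFieldNormedType.Exports.
Local Open Scope classical_set_scope.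
Local Open Scope ring_scope.
Local Open Scope complex_scope.

(** * Directional derivatives of real functions *)

(** All differential identities are proved with the upper index lowered by g: the spray equation and
    its derivatives then involve no derivative of the inverse metric, and [g_cancel] raises the
    index again afterwards. Homogeneity enters in two independent ways. In eta the spray has degree
    2, so contraction with eta turns N into 2G and the Berwald coefficients into N. In conj eta it
    has degree 0, so [LB_bar] contracted with eta vanishes; this removes the barred corrections from
    ii) and from the contraction of iii). Conditions i), ii) and iv) are equivalent at each single
    point, and iii) gives ii) pointwise; only the passage from i) to iii) differentiates the
    condition and therefore uses it in a neighbourhood. The analytic obstacle is that smoothness is
    given by iterated derivatives along real lines. Additivity in the direction and the symmetry of
    second derivatives have to be obtained by mean value arguments before any index computation can
    start. *)

Section RealCalculus.
Context {R : realType} {E : normedModType R[i]}.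
Implicit Types (u : E -> R) (q v w : E) (D : set E).

Lemma real_complex_continuous : continuous (fun t : R => t%:C).
Proof.
move=> x; apply/cvgrPdist_lt => e e0.
have eE : e = (complex.Re e)%:C by case: e e0 => a b; rewrite ltcE /= => /andP[/eqP-> _].
near=> y; rewrite -rmorphB/= normc_def/= expr0n addr0 sqrtr_sqr eE ltcR.
by near: y; apply: (nbhsx_ballx x (complex.Re e)); rewrite -ltcR -eE.
Unshelve. all: by end_near. Qed.

Lemma Re_continuous : continuous (@complex.Re R).
Proof.
move=> x; apply/(@cvgrPdist_lt _ R^o _ (nbhs (x : R[i]))) => e e0.
apply/(@nbhs_ballP R[i] R[i]); exists e%:C => /=; first by rewrite ltcR.
move=> y; rewrite /ball/= => xy.
by rewrite -ltcR -raddfB; apply: le_lt_trans (normc_ge_Re _) _.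
Qed.

Lemma Im_continuous : continuous (@complex.Im R).
Proof.
have ->: @complex.Im R = @complex.Re R \o (fun x : R[i] => x * (- 'i%C)).
  by apply/funext => x /=; rewrite mulrN raddfN/= ReiNIm opprK.
move=> x; apply: continuous_comp; last exact: Re_continuous.
exact: mulrr_continuous.
Qed.

Lemma continuous_ReIm (f : E -> R[i]) q :
  {for q, continuous (fun x => complex.Re (f x))} ->
  {for q, continuous (fun x => complex.Im (f x))} -> {for q, continuous f}.
Proof.
move=> fr fi.
have -> : f = (fun x => (complex.Re (f x))%:C + 'i%C * (complex.Im (f x))%:C).
  by apply/funext => x; rewrite -complexE.
apply: (@continuousD _ R[i]).
  apply: continuous_comp fr _; exact: real_complex_continuous.
apply: (@continuousM R[i]); first exact: cst_continuous.
by apply: continuous_comp fi _; exact: real_complex_continuous.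
Qed.

(** Two real parameters are what additivity in the direction and the symmetry of second derivatives
    require; real lines are the case where one parameter or one vector vanishes. *)
Lemma near_plane q v w (P : set E) : nbhs q P ->
  exists2 d : R, 0 < d & forall s t, `|s| <= d -> `|t| <= d ->
    P (q + s%:C *: v + t%:C *: w).
Proof.
move=> qP.
have : (fun p : R * R => q + p.1%:C *: v + p.2%:C *: w) x @[x --> (0, 0)] --> q.
  rewrite -[X in _ --> X]addr0 -[X in _ --> X + _]addr0.
  rewrite -[X in _ --> _ + X + _](scale0r v) -[X in _ --> _ + X](scale0r w).
  have rc0 : (t%:C : R[i]) @[t --> (0 : R)] --> (0 : R[i]).
    exact: (@real_complex_continuous 0).
  apply: cvgD; [apply: cvgD; [exact: cvg_cst|]|]; apply: cvgZl.
    by apply: (cvg_comp _ _ _ rc0); exact: cvg_fst.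
  by apply: (cvg_comp _ _ _ rc0); exact: cvg_snd.
move=> /(_ _ qP) [[A B] /= [/nbhs_ballP[a a0 aA] /nbhs_ballP[b b0 bB]] ABP].
(* Halving passes from the open balls to the non-strict bounds of the statement. *)
exists (Num.min a b / 2); first by rewrite divr_gt0// lt_min a0 b0.
have m2 : Num.min a b / 2 < Num.min a b.
  by rewrite ltr_pdivrMr// ltr_pMr ?ltr1n// lt_min a0 b0.
move=> s t sd td; apply: (ABP (s, t)); split => /=.
  apply: aA; rewrite /ball/= sub0r normrN (le_lt_trans sd)// (lt_le_trans m2)//.
  by rewrite ge_min lexx.
apply: bB; rewrite /ball/= sub0r normrN (le_lt_trans td)// (lt_le_trans m2)//.
by rewrite ge_min lexx orbT.
Qed.

(** The space is normed over R[i], but only real differentiability is assumed; hence the restriction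
    to a real line, with its scalars embedded by [t%:C]. *)
Definition rderivable u q v := derivable (fun t : R => u (q + t%:C *: v)) 0 1.

Definition rderive v u q : R := derive1 (fun t : R => u (q + t%:C *: v)) 0.

Lemma rderiveP u q v a : is_derive (0 : R) 1 (fun t => u (q + t%:C *: v)) a ->
  rderivable u q v /\ rderive v u q = a.
Proof. by move=> [du <-]; split => //; rewrite /rderive derive1E. Qed.

Lemma rderivableP u q v : rderivable u q v ->
  is_derive (0 : R) 1 (fun t => u (q + t%:C *: v)) (rderive v u q).
Proof. by move=> du; rewrite /rderive derive1E; exact: derivableP. Qed.

Lemma is_derive_line u q v (s : R) : rderivable u (q + s%:C *: v) v ->
  is_derive s 1 (fun t => u (q + t%:C *: v)) (rderive v u (q + s%:C *: v)).
Proof.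
move=> /rderivableP du.
have -> : (fun t : R => u (q + t%:C *: v)) =
   (fun t : R => u (q + s%:C *: v + t%:C *: v)) \o shift (- s).
  by apply/funext => t /=; rewrite -addrA -scalerDl -rmorphD/= [s + _]addrC subrK.
rewrite -[rderive _ _ _]mulr1; apply: is_derive1_comp; last exact: is_derive_shift.
by rewrite /= subrr.
Qed.

Lemma rderive_MVT u q v (h : R) : 0 < h ->
  (forall s, 0 <= s <= h -> rderivable u (q + s%:C *: v) v) ->
  exists2 s, 0 <= s <= h &
    u (q + h%:C *: v) - u q = rderive v u (q + s%:C *: v) * h.
Proof.
move=> h0 du.
have := @MVT_segment R (fun t => u (q + t%:C *: v))
  (fun s => rderive v u (q + s%:C *: v)) 0 h (ltW h0).
case.
- move=> x; rewrite in_itv/= => /andP[x0 xh].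
  by apply: is_derive_line; apply: du; rewrite !ltW.
- apply: derivable_within_continuous => x; rewrite in_itv/= => xh.
  by have [] := is_derive_line (du _ xh).
- move=> s; rewrite in_itv/= => sh.
  by rewrite scale0r addr0 subr0 => uE; exists s.
Qed.

End RealCalculus.

(** * Real functions of class C^k on an open set *)

Section SmoothReal.
Context {R : realType} {E : normedModType R[i]} (D : set E).
Hypothesis openD : open D.
Implicit Types (u : E -> R) (q v w : E).

(** The real-valued counterpart of [is_Ck]: a complex function is treated through its real and
    imaginary parts, to which one-variable real analysis applies. *)
Fixpoint rCk (k : nat) u : Prop :=
  (forall q, D q -> {for q, continuous u}) /\
  if k is k'.+1 then forall v,
    (forall q, D q -> rderivable u q v) /\ rCk k' (rderive v u)
  else True.

Lemma rCk_cont k u q : rCk k u -> D q -> {for q, continuous u}.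
Proof. by case: k => [|k] [+ _]; apply. Qed.

Lemma rCk_der k u q v : rCk k.+1 u -> D q -> rderivable u q v.
Proof. by move=> [_ /(_ v)[+ _]]; apply. Qed.

Lemma rCk_rderive k u v : rCk k.+1 u -> rCk k (rderive v u).
Proof. by move=> [_ /(_ v)[]]. Qed.

Lemma rCkS k u : rCk k.+1 u -> rCk k u.
Proof.
elim: k u => [|k IH] u [uc ud]; split=> // v; have [dv Cv] := ud v.
by split=> //; exact: IH.
Qed.

(** A short real segment through [q] stays in the open set [D]. This is why identities known only on
    [D] may be differentiated, which is done throughout. *)
Lemma near_eq_line u1 u2 q v : D q -> {in D, u1 =1 u2} ->
  \forall t \near (0 : R), u1 (q + t%:C *: v) = u2 (q + t%:C *: v).
Proof.
move=> qD u12; have [d d0 dP] := near_plane v 0 (open_nbhs_nbhs (conj openD qD)).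
apply/nbhs_ballP; exists d => //= t; rewrite /ball/= sub0r normrN => /ltW td.
apply: u12; rewrite inE -[X in D X]addr0 -(scaler0 _ 0%:C).
by apply: dP td _; rewrite normr0 ltW.
Qed.

Lemma eq_rderive u1 u2 q v : D q -> {in D, u1 =1 u2} ->
  rderive v u1 q = rderive v u2 q.
Proof.
move=> qD u12; rewrite /rderive !derive1E; apply: near_eq_derive.
exact: near_eq_line.
Qed.

Lemma eq_rderivable u1 u2 q v : D q -> {in D, u1 =1 u2} ->
  rderivable u1 q v -> rderivable u2 q v.
Proof. by move=> qD u12; apply: near_eq_derivable; exact: near_eq_line. Qed.

Lemma eq_continuous_in u1 u2 q : D q -> {in D, u1 =1 u2} ->
  {for q, continuous u1} -> {for q, continuous u2}.
Proof.
move=> qD u12; rewrite /prop_for /continuous_at -(u12 _ (mem_set qD)).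
apply: cvg_trans; apply: near_eq_cvg.
by apply: filterS (open_nbhs_nbhs (conj openD qD)) => x /mem_set/u12.
Qed.

Lemma eq_rCk k u1 u2 : {in D, u1 =1 u2} -> rCk k u1 -> rCk k u2.
Proof.
elim: k u1 u2 => [|k IH] u1 u2 u12 [uc ud]; split=> //.
- by move=> q qD; apply: eq_continuous_in (uc _ qD).
- by move=> q qD; apply: eq_continuous_in (uc _ qD).
move=> v; have [dv Cv] := ud v; split.
  by move=> q qD; apply: eq_rderivable (dv _ qD).
by apply: IH Cv => q /[!inE] qD; exact: eq_rderive.
Qed.

End SmoothReal.
Arguments rCk_der {R E D k u q} v.

Section SmoothReal2.
Context {R : realType} {E : normedModType R[i]} (D : set E).
Hypothesis openD : open D.
Implicit Types (u : E -> R) (q v w : E).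

Lemma rderive_cst (a : R) q v :
  rderivable (fun _ => a) q v /\ rderive v (fun _ => a) q = 0.
Proof. by apply: rderiveP; exact: is_derive_cst. Qed.

Lemma rderiveD u1 u2 q v : rderivable u1 q v -> rderivable u2 q v ->
  rderivable (fun x => u1 x + u2 x) q v /\
  rderive v (fun x => u1 x + u2 x) q = rderive v u1 q + rderive v u2 q.
Proof.
by move=> /rderivableP d1 /rderivableP d2; apply: rderiveP; exact: is_deriveD.
Qed.

Lemma rderiveN u q v : rderivable u q v ->
  rderivable (fun x => - u x) q v /\
  rderive v (fun x => - u x) q = - rderive v u q.
Proof. by move=> /rderivableP d; apply: rderiveP; exact: is_deriveN. Qed.

Lemma rderiveM u1 u2 q v : rderivable u1 q v -> rderivable u2 q v ->
  rderivable (fun x => u1 x * u2 x) q v /\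
  rderive v (fun x => u1 x * u2 x) q = rderive v u1 q * u2 q + u1 q * rderive v u2 q.
Proof.
move=> /rderivableP d1 /rderivableP d2; apply: rderiveP.
apply: (is_derive_eq (is_deriveM d1 d2)).
by rewrite /= scale0r addr0 addrC; congr (_ + _); rewrite /GRing.scale/= mulrC.
Qed.

Lemma rderiveV u q v : u q != 0 -> rderivable u q v ->
  rderivable (fun x => (u x)^-1) q v /\
  rderive v (fun x => (u x)^-1) q = - (u q)^-1 * (u q)^-1 * rderive v u q.
Proof.
move=> uq0 /rderivableP d; apply: rderiveP.
have uq : u (q + 0%:C *: v) != 0 by rewrite scale0r addr0.
apply: (is_derive_eq (is_deriveV uq d)).
by rewrite /= scale0r addr0 /GRing.scale/= expr2 invfM !mulNr.
Qed.

Lemma rCk_cst k (a : R) : rCk D k (fun _ => a).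
Proof.
elim: k a => [|k IH] a; split=> //; try by move=> q _; exact: cst_continuous.
move=> v; split=> [q qD|]; first by have [] := rderive_cst a q v.
have -> : rderive v (fun _ => a) = fun _ : E => 0; last exact: IH.
by apply/funext => q; have [] := rderive_cst a q v.
Qed.

Lemma rCkD k u1 u2 : rCk D k u1 -> rCk D k u2 -> rCk D k (fun x => u1 x + u2 x).
Proof.
elim: k u1 u2 => [|k IH] u1 u2 C1 C2.
  by split=> // q qD; apply: continuousD; [exact: rCk_cont C1 _|exact: rCk_cont C2 _].
split=> [q qD|v].
  by apply: continuousD; [exact: rCk_cont C1 _|exact: rCk_cont C2 _].
have H q : D q -> _ := fun qD => rderiveD (rCk_der v C1 qD) (rCk_der v C2 qD).
split=> [q /H[]//|].
apply: eq_rCk (IH _ _ (rCk_rderive v C1) (rCk_rderive v C2)) => //.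
by move=> q /[!inE] /H[].
Qed.

Lemma rCkN k u : rCk D k u -> rCk D k (fun x => - u x).
Proof.
elim: k u => [|k IH] u C1.
  by split=> // q qD; apply: continuousN; exact: rCk_cont C1 _.
split=> [q qD|v]; first by apply: continuousN; exact: rCk_cont C1 _.
have H q : D q -> _ := fun qD => rderiveN (rCk_der v C1 qD).
split=> [q /H[]//|].
apply: eq_rCk (IH _ (rCk_rderive v C1)) => //.
by move=> q /[!inE] /H[].
Qed.

Lemma rCkM k u1 u2 : rCk D k u1 -> rCk D k u2 -> rCk D k (fun x => u1 x * u2 x).
Proof.
elim: k u1 u2 => [|k IH] u1 u2 C1 C2.
  by split=> // q qD; apply: continuousM; [exact: rCk_cont C1 _|exact: rCk_cont C2 _].
split=> [q qD|v].
  by apply: continuousM; [exact: rCk_cont C1 _|exact: rCk_cont C2 _].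
have H q : D q -> _ := fun qD => rderiveM (rCk_der v C1 qD) (rCk_der v C2 qD).
split=> [q /H[]//|].
have C12 := rCkD (IH _ _ (rCk_rderive v C1) (rCkS C2))
                 (IH _ _ (rCkS C1) (rCk_rderive v C2)).
by apply: eq_rCk C12 => // q /[!inE] /H[].
Qed.

Lemma rCkV k u : (forall q, D q -> u q != 0) -> rCk D k u ->
  rCk D k (fun x => (u x)^-1).
Proof.
move=> u0; elim: k => [|k IH] C1.
  by split=> // q qD; apply: continuousV; [exact: u0|exact: rCk_cont C1 _].
split=> [q qD|v].
  by apply: continuousV; [exact: u0|exact: rCk_cont C1 _].
have H q : D q -> _ := fun qD => rderiveV (u0 q qD) (rCk_der v C1 qD).
split=> [q /H[]//|].
have CV := rCkM (rCkM (rCkN (IH (rCkS C1))) (IH (rCkS C1))) (rCk_rderive v C1).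
by apply: eq_rCk CV => // q /[!inE] /H[].
Qed.

Lemma rderiveZv u q v (a : R) : rderivable u q v ->
  rderivable u q (a%:C *: v) /\ rderive (a%:C *: v) u q = a * rderive v u q.
Proof.
move=> /rderivableP d; apply: rderiveP.
have -> : (fun t : R => u (q + t%:C *: (a%:C *: v))) =
   (fun t => u (q + t%:C *: v)) \o ( *%R a).
  by apply/funext => t /=; rewrite scalerA -rmorphM mulrC.
rewrite mulrC; apply: is_derive1_comp; first by rewrite mulr0.
apply: (is_derive_eq (is_deriveM (is_derive_cst a (0 : R) 1) (is_derive_id (0 : R) 1))).
by rewrite /= scaler0 addr0 /GRing.scale/= mulr1.
Qed.

Lemma rCk_near k u q (e : R) : D q -> rCk D k u -> 0 < e ->
  \forall x \near q, D x /\ `|u q - u x| < e.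
Proof.
move=> qD C e0; apply: filterI; first exact: open_nbhs_nbhs.
by have /cvgrPdist_lt/(_ _ e0) := rCk_cont C qD.
Qed.

(** The increment along [v + w] is the increment along [v] followed by the one along [w]. The mean
    value theorem on these three segments gives an exact additive relation between derivatives at
    three nearby points, and continuity moves each of them to [q] at a cost below [e / 3]. *)
Lemma rderiveDv u q v w : D q -> rCk D 1 u ->
  rderive (v + w) u q = rderive v u q + rderive w u q.
Proof.
move=> qD C; apply/eqP; rewrite -subr_eq0 -normr_le0; apply/ler_addgt0Pr => e e0.
have e3 : 0 < e / 3 by rewrite divr_gt0.
have near z := rCk_near qD (rCk_rderive z C) e3.
have [d d0 dP] := near_plane v w (filterI (near v) (filterI (near w) (near (v + w)))).
have inD s t : `|s| <= d -> `|t| <= d -> D (q + s%:C *: v + t%:C *: w).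
  by move=> sd td; have [[]] := dP s t sd td.
have le_abs s : 0 <= s <= d -> `|s| <= d by case/andP=> s0 sd; rewrite ger0_norm.
have dd : `|d| <= d by rewrite gtr0_norm.
have zd : `|0 : R| <= d by rewrite normr0 ltW.
have [s1 /le_abs s1d E1] := @rderive_MVT _ _ u (q + d%:C *: v) w d d0
  (fun s sd => rCk_der w C (inD _ _ dd (le_abs _ sd))).
have inv s : q + s%:C *: v = q + s%:C *: v + 0%:C *: w by rewrite scale0r addr0.
have [s2 /le_abs s2d E2] : exists2 s, 0 <= s <= d &
    u (q + d%:C *: v) - u q = rderive v u (q + s%:C *: v) * d.
  apply: rderive_MVT => // s /le_abs sd; apply: rCk_der C _.
  by rewrite inv; exact: inD.
have vw s : q + s%:C *: (v + w) = q + s%:C *: v + s%:C *: w.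
  by rewrite scalerDr addrA.
have [s3 /le_abs s3d E3] : exists2 s, 0 <= s <= d &
    u (q + d%:C *: (v + w)) - u q = rderive (v + w) u (q + s%:C *: (v + w)) * d.
  apply: rderive_MVT => // s /le_abs sd; apply: rCk_der C _.
  by rewrite vw; exact: inD.
have [_ [[_ n1] _]] := dP _ _ dd s1d.
have [[_ n2] _] := dP _ _ s2d zd; rewrite -inv in n2.
have [_ [_ [_ n3]]] := dP _ _ s3d s3d; rewrite -vw in n3.
rewrite vw in E3.
have {E1 E2 E3} E0 : rderive (v + w) u (q + s3%:C *: (v + w)) =
    rderive v u (q + s2%:C *: v) + rderive w u (q + d%:C *: v + s1%:C *: w).
  by apply: (mulIf (lt0r_neq0 d0)); rewrite mulrDl -E1 -E2 -E3; ring.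
rewrite add0r; move: n1 n2 n3; rewrite {}E0 {dP vw inv}.
move: (rderive v u q) (rderive w u q) (rderive (v + w) u q) => A B S.
move: (rderive v u _) (rderive w u _) => A' B'.
rewrite !ltr_norml ler_norml => /andP[? ?] /andP[? ?] /andP[? ?].
by apply/andP; split; lra.
Qed.

(* Both mixed derivatives approximate the same second difference quotient. *)
Lemma rderiveC u q v w : D q -> rCk D 2 u ->
  rderive v (rderive w u) q = rderive w (rderive v u) q.
Proof.
move=> qD C.
have mixed v' w' (e : R) : 0 < e -> \forall d \near (0 : R)^'+,
    `|rderive w' (rderive v' u) q - (u (q + d%:C *: v' + d%:C *: w') - u (q + d%:C *: v')
      - u (q + d%:C *: w') + u q) / (d * d)| < e.
  move=> e0.
  have [d d0 dP] := near_plane v' w'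
    (rCk_near qD (rCk_rderive w' (rCk_rderive v' C)) e0).
  near=> h.
  have h0 : 0 < h by near: h; exact: nbhs_right_gt.
  have hd : h <= d by near: h; exact: nbhs_right_le.
  have le_abs s : 0 <= s <= h -> `|s| <= d.
    by case/andP=> s0 sh; rewrite ger0_norm// (le_trans sh).
  have hh : `|h| <= d by rewrite gtr0_norm.
  have zd : `|0 : R| <= d by rewrite normr0 ltW.
  have inD s t : `|s| <= d -> `|t| <= d -> D (q + s%:C *: v' + t%:C *: w').
    by move=> sd td; have [] := dP s t sd td.
  (* The second difference of [u] is the increment of [g] along [v']; one mean value in direction
     [v'] and one in direction [w'] make it a mixed derivative at an intermediate point times
     [h * h]. *)
  pose g x := u (x + h%:C *: w') - u x.
  have C1 := rCkS C.
  have inD0 s : `|s| <= d -> D (q + s%:C *: v').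
    by move=> sd; have := inD _ _ sd zd; rewrite scale0r addr0.
  have gder s : 0 <= s <= h -> rderivable g (q + s%:C *: v') v' /\
      rderive v' g (q + s%:C *: v') =
      rderive v' u (q + s%:C *: v' + h%:C *: w') - rderive v' u (q + s%:C *: v').
    move=> /le_abs sd.
    have d2 := rderivableP (rCk_der v' C1 (inD0 _ sd)).
    have := rderivableP (rCk_der v' C1 (inD _ _ sd hh)).
    have -> : (fun t : R => u (q + s%:C *: v' + h%:C *: w' + t%:C *: v')) =
      (fun t : R => u (q + s%:C *: v' + t%:C *: v' + h%:C *: w')).
      by apply/funext => t; rewrite addrAC.
    by move=> d1; apply: rderiveP; exact: is_deriveB.
  have [s sh] := @rderive_MVT _ _ g q v' h h0 (fun s sh => (gder s sh).1).
  rewrite (gder s sh).2 /g => E1.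
  have [t th E2] : exists2 t, 0 <= t <= h & rderive v' u (q + s%:C *: v' + h%:C *: w')
      - rderive v' u (q + s%:C *: v') =
      rderive w' (rderive v' u) (q + s%:C *: v' + t%:C *: w') * h.
    apply: rderive_MVT => // t th; apply: rCk_der (rCk_rderive v' C) _.
    by apply: inD; exact: le_abs.
  rewrite E2 in E1.
  have -> : u (q + h%:C *: v' + h%:C *: w') - u (q + h%:C *: v') - u (q + h%:C *: w')
      + u q = rderive w' (rderive v' u) (q + s%:C *: v' + t%:C *: w') * h * h.
    by rewrite -E1; ring.
  rewrite -[X in X / _]mulrA mulfK ?mulf_neq0 ?gt_eqF//.
  by have [] := dP s t (le_abs _ sh) (le_abs _ th).
apply/eqP; rewrite -subr_eq0 -normr_le0; apply/ler_addgt0Pr => e e0.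
have e2 : 0 < e / 2 by rewrite divr_gt0.
(* One step size serves both orders; exchanging [v] and [w] only permutes terms of the second
   difference. *)
have [h [+ +]] := @filter_ex _ _ _ _ (filterI (mixed v w _ e2) (mixed w v _ e2)).
rewrite (addrAC q (h%:C *: w)) [u _ - u (q + h%:C *: w) - _]addrAC add0r.
move: (rderive v _ _) (rderive w _ _) (_ / (h * h)) => B B' A.
by rewrite !ltr_norml ler_norml => /andP[? ?] /andP[? ?]; apply/andP; split; lra.
Unshelve. all: by end_near. Qed.

End SmoothReal2.

(** * Smooth complex functions and Wirtinger operators *)

Section SmoothComplex.
Context {R : realType} {n : nat} (D : set ('rV[R[i]]_n * 'rV[R[i]]_n)).
Hypothesis openD : open D.
Local Notation V := 'rV[R[i]]_n.
Implicit Types (f g : V * V -> R[i]) (q v w : V * V).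

Lemma complex_ext (x y : R[i]) :
  complex.Re x = complex.Re y -> complex.Im x = complex.Im y -> x = y.
Proof. by case: x y => [a b] [c d] /= -> ->. Qed.

Lemma ReD_complex (x y : R[i]) :
  complex.Re (x + y) = complex.Re x + complex.Re y.
Proof. exact: raddfD. Qed.

Lemma ImD_complex (x y : R[i]) :
  complex.Im (x + y) = complex.Im x + complex.Im y.
Proof. exact: raddfD. Qed.

Lemma Re_real_derive v f q :
  complex.Re (real_derive v f q) = rderive v (fun x => complex.Re (f x)) q.
Proof. by []. Qed.

Lemma Im_real_derive v f q :
  complex.Im (real_derive v f q) = rderive v (fun x => complex.Im (f x)) q.
Proof. by []. Qed.

Lemma is_CkE k f : is_Ck k D f <->
  rCk D k (fun x => complex.Re (f x)) /\ rCk D k (fun x => complex.Im (f x)).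
Proof.
have cont g : (forall q, D q -> {for q, continuous g}) <->
    (forall q, D q -> {for q, continuous (fun x => complex.Re (g x))}) /\
    (forall q, D q -> {for q, continuous (fun x => complex.Im (g x))}).
  split=> [gc|[gr gi] q qD]; last by apply: continuous_ReIm; [exact: gr|exact: gi].
  by split=> q /gc qg; apply: continuous_comp qg _;
    [exact: Re_continuous|exact: Im_continuous].
elim: k f => [|k IH] f /=.
  by split=> [[/cont[]]|[[fr _] [fi _]]]//; split=> //; apply/cont.
split=> [[/cont[fr fi] fd]|[[fr dr] [fi di]]].
  split; split=> // v; have [dv /IH[Cr Ci]] := fd v.
    by split=> [q /dv[]|]; last exact: Cr.
  by split=> [q /dv[]|]; last exact: Ci.
split; first by apply/cont.
move=> v; have [dfr Cr] := dr v; have [dfi Ci] := di v.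
by split=> [q qD|]; [split; [exact: dfr|exact: dfi]|apply/IH].
Qed.

Lemma smooth_onE f : smooth_on D f <->
  (forall k, rCk D k (fun x => complex.Re (f x))) /\
  (forall k, rCk D k (fun x => complex.Im (f x))).
Proof.
split=> [fs|[fr fi] k]; last by apply/is_CkE.
by split=> k; have /is_CkE[] := fs k.
Qed.

Lemma smooth_rderivable f q v : smooth_on D f -> D q ->
  rderivable (fun x => complex.Re (f x)) q v /\
  rderivable (fun x => complex.Im (f x)) q v.
Proof.
by move=> /smooth_onE[/(_ 1) fr /(_ 1) fi] qD;
   split; [exact: rCk_der fr qD|exact: rCk_der fi qD].
Qed.

Lemma eq_smooth f g : {in D, f =1 g} -> smooth_on D f -> smooth_on D g.
Proof.
move=> fg /smooth_onE[fr fi]; apply/smooth_onE; split=> k.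
  by apply: eq_rCk (fr k) => // q qD; rewrite fg.
by apply: eq_rCk (fi k) => // q qD; rewrite fg.
Qed.

Lemma smooth_cst (a : R[i]) : smooth_on D (fun _ => a).
Proof. by apply/smooth_onE; split=> k; exact: rCk_cst. Qed.

Lemma smoothD f g : smooth_on D f -> smooth_on D g ->
  smooth_on D (fun x => f x + g x).
Proof.
move=> /smooth_onE[fr fi] /smooth_onE[gr gi]; apply/smooth_onE.
split=> k; first by apply: eq_rCk (rCkD openD (fr k) (gr k)) => // q _; rewrite raddfD.
by apply: eq_rCk (rCkD openD (fi k) (gi k)) => // q _; rewrite raddfD.
Qed.

Lemma ReM_complex (x y : R[i]) :
  complex.Re (x * y) = complex.Re x * complex.Re y - complex.Im x * complex.Im y.
Proof. by case: x y => [a b] [c d]. Qed.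

Lemma ImM_complex (x y : R[i]) :
  complex.Im (x * y) = complex.Re x * complex.Im y + complex.Im x * complex.Re y.
Proof. by case: x y => [a b] [c d] /=. Qed.

Lemma ReZ_complex (t : R) (x : R[i]) : complex.Re (t%:C * x) = t * complex.Re x.
Proof. by rewrite ReM_complex mul0r subr0. Qed.

Lemma ImZ_complex (t : R) (x : R[i]) : complex.Im (t%:C * x) = t * complex.Im x.
Proof. by rewrite ImM_complex mul0r addr0. Qed.

Lemma smoothM f g : smooth_on D f -> smooth_on D g ->
  smooth_on D (fun x => f x * g x).
Proof.
move=> /smooth_onE[fr fi] /smooth_onE[gr gi]; apply/smooth_onE; split=> k.
  apply: (eq_rCk openD _ (rCkD openD (rCkM openD (fr k) (gr k))
    (rCkN openD (rCkM openD (fi k) (gi k))))) => q _.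
  by rewrite ReM_complex.
apply: (eq_rCk openD _ (rCkD openD (rCkM openD (fr k) (gi k))
  (rCkM openD (fi k) (gr k)))) => q _.
by rewrite ImM_complex.
Qed.

Lemma smoothN f : smooth_on D f -> smooth_on D (fun x => - f x).
Proof.
move=> fs; apply: eq_smooth (smoothM (smooth_cst (-1)) fs) => q _.
by rewrite mulN1r.
Qed.

Lemma smoothB f g : smooth_on D f -> smooth_on D g ->
  smooth_on D (fun x => f x - g x).
Proof. by move=> fs gs; apply: smoothD => //; exact: smoothN. Qed.

Lemma smoothV f : (forall q, D q -> f q != 0) -> smooth_on D f ->
  smooth_on D (fun x => (f x)^-1).
Proof.
move=> f0 /smooth_onE[fr fi].
(* The squared modulus is the common denominator of the real and imaginary parts of the inverse. *)
have n0 q : D q -> complex.Re (f q) * complex.Re (f q) +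
    complex.Im (f q) * complex.Im (f q) != 0.
  move=> /f0; apply: contra; rewrite -!expr2 paddr_eq0 ?sqr_ge0// !sqrf_eq0.
  by case: (f q) => a b /andP[/eqP/= -> /eqP/= ->].
have Cn k := rCkV openD n0 (rCkD openD (rCkM openD (fr k) (fr k))
  (rCkM openD (fi k) (fi k))).
apply/smooth_onE; split=> k.
  apply: (eq_rCk openD _ (rCkM openD (fr k) (Cn k))) => q _.
  by case: (f q) => a b /=; rewrite -!expr2.
apply: (eq_rCk openD _ (rCkM openD (rCkN openD (fi k)) (Cn k))) => q _.
by case: (f q) => a b /=; rewrite -!expr2 mulNr.
Qed.

Lemma smooth_sum (I : Type) (r : seq I) (P : pred I) (F : I -> V * V -> R[i]) :
  (forall i, smooth_on D (F i)) -> smooth_on D (fun x => \sum_(i <- r | P i) F i x).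
Proof.
move=> Fs; elim: r => [|i r IH].
  by apply: eq_smooth (smooth_cst 0) => q _; rewrite big_nil.
case: (boolP (P i)) => Pi.
  by apply: eq_smooth (smoothD (Fs i) IH) => q _; rewrite big_cons Pi.
by apply: eq_smooth IH => q _; rewrite big_cons (negbTE Pi).
Qed.

Lemma smooth_prod (I : Type) (r : seq I) (F : I -> V * V -> R[i]) :
  (forall i, smooth_on D (F i)) -> smooth_on D (fun x => \prod_(i <- r) F i x).
Proof.
move=> Fs; elim: r => [|i r IH].
  by apply: eq_smooth (smooth_cst 1) => q _; rewrite big_nil.
by apply: eq_smooth (smoothM (Fs i) IH) => q _; rewrite big_cons.
Qed.

Lemma smooth_det m (A : V * V -> 'M[R[i]]_m) :
  (forall i j, smooth_on D (fun q => A q i j)) -> smooth_on D (fun q => \det (A q)).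
Proof.
move=> As; apply: smooth_sum => s; apply: smoothM; first exact: smooth_cst.
exact: smooth_prod.
Qed.

(** Cramer's rule: the entries are cofactors divided by the determinant, and both are polynomials in
    the entries of [A]. *)
Lemma smooth_invmx m (A : V * V -> 'M[R[i]]_m) i j :
  (forall q, D q -> A q \in unitmx) ->
  (forall i j, smooth_on D (fun q => A q i j)) ->
  smooth_on D (fun q => invmx (A q) i j).
Proof.
move=> Au As.
have cof : smooth_on D (fun q => cofactor (A q) j i).
  apply: smoothM; first exact: smooth_cst.
  apply: smooth_det => k l.
  by apply: eq_smooth (As (lift j k) (lift i l)) => q _; rewrite !mxE.
have det0 q : D q -> \det (A q) != 0 by move=> /Au; rewrite unitmxE unitfE.
apply: eq_smooth (smoothM (smoothV det0 (smooth_det As)) cof) => q.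
by rewrite inE => /Au Aq; rewrite /invmx Aq !mxE.
Qed.

Lemma smooth_real_derive v f : smooth_on D f -> smooth_on D (real_derive v f).
Proof. by move=> fs k; have [_ /(_ v)[]] := fs k.+1. Qed.

Lemma eq_real_derive v f g q : D q -> {in D, f =1 g} ->
  real_derive v f q = real_derive v g q.
Proof.
move=> qD fg; apply: complex_ext; rewrite ?Re_real_derive ?Im_real_derive.
  by apply: (eq_rderive openD _ qD) => // x xD; rewrite fg.
by apply: (eq_rderive openD _ qD) => // x xD; rewrite fg.
Qed.

Lemma real_derive_cst v (a : R[i]) q : real_derive v (fun _ => a) q = 0.
Proof.
apply: complex_ext; first exact: (rderive_cst (complex.Re a) q v).2.
exact: (rderive_cst (complex.Im a) q v).2.
Qed.

Lemma real_deriveD v f g q : smooth_on D f -> smooth_on D g -> D q ->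
  real_derive v (fun x => f x + g x) q = real_derive v f q + real_derive v g q.
Proof.
move=> fs gs qD; have [fr fi] := smooth_rderivable v fs qD.
have [gr gi] := smooth_rderivable v gs qD.
apply: complex_ext; rewrite ?ReD_complex ?ImD_complex ?Re_real_derive ?Im_real_derive.
  rewrite -(rderiveD fr gr).2.
  by apply: (eq_rderive openD _ qD) => // x _; rewrite ReD_complex.
rewrite -(rderiveD fi gi).2.
by apply: (eq_rderive openD _ qD) => // x _; rewrite ImD_complex.
Qed.

Lemma real_deriveM v f g q : smooth_on D f -> smooth_on D g -> D q ->
  real_derive v (fun x => f x * g x) q =
  real_derive v f q * g q + f q * real_derive v g q.
Proof.
move=> fs gs qD; have [fr fi] := smooth_rderivable v fs qD.
have [gr gi] := smooth_rderivable v gs qD.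
apply: complex_ext.
  rewrite ReD_complex !ReM_complex !Re_real_derive !Im_real_derive.
  have [mr mrE] := rderiveM fr gr; have [mi miE] := rderiveM fi gi.
  have [ni niE] := rderiveN mi.
  transitivity (rderive v (fun x => complex.Re (f x) * complex.Re (g x)
     + - (complex.Im (f x) * complex.Im (g x))) q).
    by apply: (eq_rderive openD _ qD) => // x _; rewrite ReM_complex.
  by rewrite (rderiveD mr ni).2 niE mrE miE; ring.
rewrite ImD_complex !ImM_complex !Re_real_derive !Im_real_derive.
have [mr mrE] := rderiveM fr gi; have [mi miE] := rderiveM fi gr.
transitivity (rderive v (fun x => complex.Re (f x) * complex.Im (g x)
   + complex.Im (f x) * complex.Re (g x)) q).
  by apply: (eq_rderive openD _ qD) => // x _; rewrite ImM_complex.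
by rewrite (rderiveD mr mi).2 mrE miE; ring.
Qed.

Lemma real_deriveZ v (a : R[i]) f q : smooth_on D f -> D q ->
  real_derive v (fun x => a * f x) q = a * real_derive v f q.
Proof.
move=> fs qD; rewrite (real_deriveM v (smooth_cst a) fs qD).
by rewrite (real_derive_cst v a q) mul0r add0r.
Qed.

Lemma real_derive_conj v f q : smooth_on D f -> D q ->
  real_derive v (fun x => (f x)^*) q = (real_derive v f q)^*.
Proof.
move=> fs qD; have [fr fi] := smooth_rderivable v fs qD.
apply: complex_ext.
  rewrite Re_real_derive; transitivity (rderive v (fun x => complex.Re (f x)) q) => //.
  by apply: (eq_rderive openD _ qD) => // x _; case: (f x).
rewrite Im_real_derive; transitivity (rderive v (fun x => - complex.Im (f x)) q).
  by apply: (eq_rderive openD _ qD) => // x _; case: (f x).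
by rewrite (rderiveN fi).2.
Qed.

Lemma real_deriveDv v w f q : smooth_on D f -> D q ->
  real_derive (v + w) f q = real_derive v f q + real_derive w f q.
Proof.
move=> /smooth_onE[/(_ 1) fr /(_ 1) fi] qD.
apply: complex_ext; first exact: (rderiveDv openD v w qD fr).
exact: (rderiveDv openD v w qD fi).
Qed.

Lemma real_deriveZv v f q (a : R) : smooth_on D f -> D q ->
  real_derive (a%:C *: v) f q = a%:C * real_derive v f q.
Proof.
move=> fs qD; have [fr fi] := smooth_rderivable v fs qD.
apply: complex_ext; rewrite ?ReM_complex ?ImM_complex !mul0r ?addr0 ?subr0;
  rewrite ?Re_real_derive ?Im_real_derive.
  exact: (rderiveZv _ fr).2.
exact: (rderiveZv _ fi).2.
Qed.

Lemma real_deriveC v w f q : smooth_on D f -> D q ->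
  real_derive v (real_derive w f) q = real_derive w (real_derive v f) q.
Proof.
move=> /smooth_onE[/(_ 2) fr /(_ 2) fi] qD.
apply: complex_ext; first exact: (rderiveC openD v w qD fr).
exact: (rderiveC openD v w qD fi).
Qed.

(** The first derivatives are constant, so no induction on the order is needed. The case in view is
    that of the coordinate functions eta^j, which enter every contraction. *)
Lemma smooth_real_linear (l : V * V -> R[i]) : continuous l ->
  (forall q v (t : R), l (q + t%:C *: v) = l q + t%:C * l v) ->
  smooth_on D l /\ forall v q, real_derive v l q = l v.
Proof.
move=> lc ll.
have H (p : R[i] -> R) : continuous p -> (forall a b, p (a + b) = p a + p b) ->
    (forall (t : R) a, p (t%:C * a) = t * p a) ->
    (forall k, rCk D k (fun x => p (l x))) /\
    forall v q, rderive v (fun x => p (l x)) q = p (l v).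
  move=> pc pD pZ.
  have d v q : rderivable (fun x => p (l x)) q v /\
      rderive v (fun x => p (l x)) q = p (l v).
    apply: rderiveP.
    have -> : (fun t : R => p (l (q + t%:C *: v))) = (fun t => p (l q) + t * p (l v)).
      by apply/funext => t; rewrite ll pD pZ.
    apply: (is_derive_eq (is_deriveD (is_derive_cst (p (l q)) (0 : R) 1)
      (is_deriveM (is_derive_id (0 : R) 1) (is_derive_cst (p (l v)) (0 : R) 1)))).
    by rewrite scaler0 !add0r /GRing.scale/= mulr1.
  have c q : {for q, continuous (fun x => p (l x))}.
    by apply: continuous_comp; [exact: lc|exact: pc].
  split=> [k|v q]; last exact: (d v q).2.
  case: k => [|k]; split=> // v; split=> [q _|]; first exact: (d v q).1.
  have -> : rderive v (fun x => p (l x)) = fun=> p (l v).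
    by apply/funext => q; exact: (d v q).2.
  exact: rCk_cst.
have [rs rd] := H (@complex.Re R) (@Re_continuous R) (raddfD _)
  (fun t a => ReZ_complex t a).
have [is' id'] := H (@complex.Im R) (@Im_continuous R) (raddfD _)
  (fun t a => ImZ_complex t a).
split; first by apply/smooth_onE.
by move=> v q; apply: complex_ext; [exact: rd|exact: id'].
Qed.

End SmoothComplex.

(** * Wirtinger operators and contractions with eta *)

Section Wirtinger.
Context {R : realType} {n : nat} (D : set ('rV[R[i]]_n * 'rV[R[i]]_n)).
Hypothesis openD : open D.
Local Notation V := 'rV[R[i]]_n.
Implicit Types (f g : V * V -> R[i]) (q v w : V * V) (d : (V * V -> R[i]) -> V * V -> R[i]).

(** The common shape of [dz], [dzb], [deta] and [detab], so that linearity, the product rule and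
    commutation are proved once for all four. *)
Definition wirtinger d := exists a b v, d = fun f q =>
  a * real_derive v f q + b * real_derive ('i *: v) f q.

Lemma wirt_wirtinger v : wirtinger (wirt v).
Proof.
exists 2^-1, (- (2^-1 * 'i)), v; apply/funext => f; apply/funext => q.
by rewrite /wirt mulrBr mulrA mulNr.
Qed.

Lemma wirt_bar_wirtinger v : wirtinger (wirt_bar v).
Proof.
exists 2^-1, (2^-1 * 'i), v; apply/funext => f; apply/funext => q.
by rewrite /wirt_bar mulrDr mulrA.
Qed.

Lemma smooth_wirtinger d f : wirtinger d -> smooth_on D f -> smooth_on D (d f).
Proof.
by move=> [a [b [v ->]]] fs; apply: smoothD => //; apply: smoothM => //;
   do ?[exact: smooth_cst]; exact: smooth_real_derive.
Qed.

Lemma eq_wirtinger d f g q : wirtinger d -> D q -> {in D, f =1 g} -> d f q = d g q.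
Proof.
by move=> [a [b [v ->]]] qD fg; rewrite !(eq_real_derive openD _ qD fg).
Qed.

Lemma wirtinger_cst d (a : R[i]) q : wirtinger d -> d (fun _ => a) q = 0.
Proof. by move=> [b [c [v ->]]]; rewrite !real_derive_cst !mulr0 addr0. Qed.

Lemma wirtingerD d f g q : wirtinger d -> smooth_on D f -> smooth_on D g -> D q ->
  d (fun x => f x + g x) q = d f q + d g q.
Proof.
move=> [a [b [v ->]]] fs gs qD.
by rewrite !(real_deriveD openD _ fs gs qD); ring.
Qed.

Lemma wirtingerM d f g q : wirtinger d -> smooth_on D f -> smooth_on D g -> D q ->
  d (fun x => f x * g x) q = d f q * g q + f q * d g q.
Proof.
move=> [a [b [v ->]]] fs gs qD.
by rewrite !(real_deriveM openD _ fs gs qD); ring.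
Qed.

Lemma wirtingerZ d (a : R[i]) f q : wirtinger d -> smooth_on D f -> D q ->
  d (fun x => a * f x) q = a * d f q.
Proof.
move=> dw fs qD; rewrite (wirtingerM dw (smooth_cst D a) fs qD).
by rewrite (wirtinger_cst _ _ dw) mul0r add0r.
Qed.

Lemma wirtinger_sum d (I : Type) (r : seq I) (F : I -> V * V -> R[i]) q :
  wirtinger d -> (forall i, smooth_on D (F i)) -> D q ->
  d (fun x => \sum_(i <- r) F i x) q = \sum_(i <- r) d (F i) q.
Proof.
move=> dw Fs qD; elim: r => [|i r IH].
  rewrite big_nil -[RHS](wirtinger_cst 0 q dw).
  by apply: eq_wirtinger => // x _; rewrite big_nil.
rewrite big_cons -IH -wirtingerD//; last exact: smooth_sum.
by apply: eq_wirtinger => // x _; rewrite big_cons.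
Qed.

Lemma wirtingerC d d' f q : wirtinger d -> wirtinger d' -> smooth_on D f -> D q ->
  d (d' f) q = d' (d f) q.
Proof.
move=> [a [b [v ->]]] [a' [b' [v' ->]]] fs qD.
have rdC w w' := real_deriveC openD w w' fs qD.
have lin w (c c' : R[i]) w1 w2 :
    real_derive w (fun x => c * real_derive w1 f x + c' * real_derive w2 f x) q
    = c * real_derive w (real_derive w1 f) q + c' * real_derive w (real_derive w2 f) q.
  have rs z := smooth_real_derive z fs.
  have cs z := smooth_cst D z.
  rewrite (real_deriveD openD w (smoothM openD (cs c) (rs w1))
    (smoothM openD (cs c') (rs w2)) qD).
  by rewrite (real_deriveZ openD w c (rs w1) qD) (real_deriveZ openD w c' (rs w2) qD).
rewrite !lin (rdC v' v) (rdC v' ('i *: v)) (rdC ('i *: v') v) (rdC ('i *: v') ('i *: v)).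
move: (real_derive v (real_derive v' f) q)
  (real_derive ('i *: v) (real_derive v' f) q)
  (real_derive v (real_derive ('i *: v') f) q)
  (real_derive ('i *: v) (real_derive ('i *: v') f) q) => A B A' B'.
ring.
Qed.

Lemma wirt_conj v f q : smooth_on D f -> D q ->
  conjc (wirt_bar v f q) = wirt v (fun x => conjc (f x)) q.
Proof.
move=> fs qD; rewrite /wirt /wirt_bar !(real_derive_conj openD _ fs qD).
have iJ : conjc ('i : R[i]) = - 'i.
  by rewrite -complexiE; apply: complex_ext; rewrite /= ?oppr0.
have cM (x y : R[i]) : conjc (x * y) = conjc x * conjc y := rmorphM _ x y.
have cD (x y : R[i]) : conjc (x + y) = conjc x + conjc y := rmorphD _ x y.
have cV : conjc (2^-1 : R[i]) = 2^-1 by rewrite conjc_inv conjc_nat.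
by rewrite cM cD cM cV iJ mulNr.
Qed.

Lemma wirtDv v w f q : smooth_on D f -> D q ->
  wirt (v + w) f q = wirt v f q + wirt w f q /\
  wirt_bar (v + w) f q = wirt_bar v f q + wirt_bar w f q.
Proof.
move=> fs qD; rewrite /wirt /wirt_bar scalerDr !(real_deriveDv openD _ _ fs qD).
move: (real_derive v f q) (real_derive w f q) (real_derive ('i *: v) f q)
  (real_derive ('i *: w) f q) => A B A' B'.
by split; ring.
Qed.

(** The real derivative is R-linear in the direction; [wirt] is its C-linear part and [wirt_bar] its
    conjugate-linear part. The computation splits [c] into real and imaginary parts and uses i * i =
    -1. *)
Lemma wirtZv (c : R[i]) v f q : smooth_on D f -> D q ->
  wirt (c *: v) f q = c * wirt v f q /\
  wirt_bar (c *: v) f q = conjc c * wirt_bar v f q.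
Proof.
move=> fs qD; rewrite /wirt /wirt_bar.
have ii : 'i * 'i = -1 :> R[i] by rewrite -expr2 sqrCi.
have cE : c = (complex.Re c)%:C + (complex.Im c)%:C * 'i.
  by rewrite mulrC -complexiE -complexE.
have icE : 'i * c = (complex.Re c)%:C * 'i + (- complex.Im c)%:C.
  by rewrite [in LHS]cE rmorphN; ring: ii.
have cJ : conjc c = (complex.Re c)%:C - (complex.Im c)%:C * 'i.
  by rewrite -complexiE; apply: complex_ext; case: (c) => a b /=; ring.
have dc : real_derive (c *: v) f q = (complex.Re c)%:C * real_derive v f q
    + (complex.Im c)%:C * real_derive ('i *: v) f q.
  rewrite [in LHS]cE scalerDl -scalerA (real_deriveDv openD _ _ fs qD).
  by rewrite !(real_deriveZv _ _ fs qD).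
have dic : real_derive ('i *: (c *: v)) f q =
    (complex.Re c)%:C * real_derive ('i *: v) f q
    - (complex.Im c)%:C * real_derive v f q.
  rewrite scalerA icE scalerDl -scalerA (real_deriveDv openD _ _ fs qD).
  by rewrite !(real_deriveZv _ _ fs qD) rmorphN mulNr.
rewrite dc dic cJ; move: cE; move: (complex.Re c)%:C (complex.Im c)%:C
  (real_derive v f q) (real_derive ('i *: v) f q) => x y A B ->.
by split; ring: ii.
Qed.

Lemma eta_smooth j : smooth_on D (fun x => x.2 0 j) /\
  forall v q, real_derive v (fun x => x.2 0 j) q = v.2 0 j.
Proof.
apply: smooth_real_linear => // [q|q v t]; last by rewrite !mxE.
apply: (continuous_comp (f := snd) (g := fun M : V => M 0 j)).
  exact: cvg_snd.
exact: coord_continuous.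
Qed.

Lemma smooth_conj f : smooth_on D f -> smooth_on D (fun x => conjc (f x)).
Proof.
move=> /smooth_onE[fr fi]; apply/smooth_onE; split=> k.
  by apply: (eq_rCk openD _ (fr k)) => x _; case: (f x).
by apply: (eq_rCk openD _ (rCkN openD (fi k))) => x _; case: (f x).
Qed.

Lemma wirt_eta v j q : D q ->
  [/\ wirt v (fun x => x.2 0 j) q = v.2 0 j,
      wirt_bar v (fun x => x.2 0 j) q = 0,
      wirt v (fun x => conjc (x.2 0 j)) q = 0 &
      wirt_bar v (fun x => conjc (x.2 0 j)) q = conjc (v.2 0 j)].
Proof.
move=> qD; have [es ed] := eta_smooth j.
have ii : 'i * 'i = -1 :> R[i] by rewrite -expr2 sqrCi.
have iJ (x : R[i]) : conjc ('i * x) = - 'i * conjc x.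
  by rewrite -complexiE; case: x => a b; apply: complex_ext; rewrite /=; ring.
rewrite /wirt /wirt_bar !(real_derive_conj openD _ es qD) !ed.
have -> : ('i *: v).2 0 j = 'i * v.2 0 j by rewrite mxE.
rewrite iJ; move: (v.2 0 j) (conjc _) => x y.
have x2 (z : R[i]) : 2^-1 * (z + z) = z by rewrite -mulr2n -[z *+ 2]mulr_natl mulKf ?pnatr_eq0.
split.
- by rewrite -[RHS]x2; ring: ii.
- by ring: ii.
- by ring: ii.
- by rewrite -[RHS]x2; ring: ii.
Qed.

Lemma wirtinger_contract d (e F : 'I_n -> V * V -> R[i]) q : wirtinger d ->
  (forall k, smooth_on D (e k)) -> (forall k, smooth_on D (F k)) -> D q ->
  d (fun x => \sum_(k < n) e k x * F k x) q =
  \sum_(k < n) d (e k) q * F k q + \sum_(k < n) e k q * d (F k) q.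
Proof.
move=> dw es Fs qD; rewrite wirtinger_sum//; last by move=> k; exact: smoothM.
by rewrite -big_split; apply: eq_bigr => k _; rewrite (wirtingerM dw).
Qed.

Lemma sum_delta (F : 'I_n -> R[i]) j :
  \sum_(k < n) (delta_mx 0 j : V) 0 k * F k = F j.
Proof.
rewrite (bigD1 j)//= mxE !eqxx mul1r big1 ?addr0// => k kj.
by rewrite mxE (negbTE kj) andbF mul0r.
Qed.

(** In this family of lemmas the free term [F j] appears only when the operator and the contracting
    coordinate are of the same type: [deta] with eta, [detab] with conj eta. In the other cases the
    contracting coordinate behaves as a constant. *)
Lemma deta_contract j (F : 'I_n -> V * V -> R[i]) q :
  (forall k, smooth_on D (F k)) -> D q ->
  deta j (fun x => \sum_(k < n) x.2 0 k * F k x) q =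
  F j q + \sum_(k < n) q.2 0 k * deta j (F k) q.
Proof.
move=> Fs qD; apply: etrans (wirtinger_contract (wirt_wirtinger (0, delta_mx 0 j))
  (fun k => (eta_smooth k).1) Fs qD) _.
congr (_ + _); rewrite -[RHS](sum_delta (fun k => F k q)).
by apply: eq_bigr => k _; have [-> _ _ _] := wirt_eta (0, delta_mx 0 j) k qD.
Qed.

Lemma detab_contract j (F : 'I_n -> V * V -> R[i]) q :
  (forall k, smooth_on D (F k)) -> D q ->
  detab j (fun x => \sum_(k < n) x.2 0 k * F k x) q =
  \sum_(k < n) q.2 0 k * detab j (F k) q.
Proof.
move=> Fs qD; apply: etrans (wirtinger_contract (wirt_bar_wirtinger (0, delta_mx 0 j))
  (fun k => (eta_smooth k).1) Fs qD) _.
rewrite big1 ?add0r// => k _.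
by have [_ -> _ _] := wirt_eta (0, delta_mx 0 j) k qD; rewrite mul0r.
Qed.

Lemma dz_contract j (F : 'I_n -> V * V -> R[i]) q :
  (forall k, smooth_on D (F k)) -> D q ->
  dz j (fun x => \sum_(k < n) x.2 0 k * F k x) q =
  \sum_(k < n) q.2 0 k * dz j (F k) q.
Proof.
move=> Fs qD; apply: etrans (wirtinger_contract (wirt_wirtinger (delta_mx 0 j, 0))
  (fun k => (eta_smooth k).1) Fs qD) _.
rewrite big1 ?add0r// => k _.
by have [-> _ _ _] := wirt_eta (delta_mx 0 j, 0) k qD; rewrite mxE mul0r.
Qed.

Lemma deta_contractb j (F : 'I_n -> V * V -> R[i]) q :
  (forall k, smooth_on D (F k)) -> D q ->
  deta j (fun x => \sum_(k < n) conjc (x.2 0 k) * F k x) q =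
  \sum_(k < n) conjc (q.2 0 k) * deta j (F k) q.
Proof.
move=> Fs qD.
apply: etrans (wirtinger_contract (wirt_wirtinger (0, delta_mx 0 j))
  (fun k => smooth_conj (eta_smooth k).1) Fs qD) _.
rewrite big1 ?add0r// => k _.
by have [_ _ -> _] := wirt_eta (0, delta_mx 0 j) k qD; rewrite mul0r.
Qed.

Lemma dz_contractb j (F : 'I_n -> V * V -> R[i]) q :
  (forall k, smooth_on D (F k)) -> D q ->
  dz j (fun x => \sum_(k < n) conjc (x.2 0 k) * F k x) q =
  \sum_(k < n) conjc (q.2 0 k) * dz j (F k) q.
Proof.
move=> Fs qD.
apply: etrans (wirtinger_contract (wirt_wirtinger (delta_mx 0 j, 0))
  (fun k => smooth_conj (eta_smooth k).1) Fs qD) _.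
rewrite big1 ?add0r// => k _.
by have [_ _ -> _] := wirt_eta (delta_mx 0 j, 0) k qD; rewrite mul0r.
Qed.

Lemma detab_contractb j (F : 'I_n -> V * V -> R[i]) q :
  (forall k, smooth_on D (F k)) -> D q ->
  detab j (fun x => \sum_(k < n) conjc (x.2 0 k) * F k x) q =
  F j q + \sum_(k < n) conjc (q.2 0 k) * detab j (F k) q.
Proof.
move=> Fs qD.
apply: etrans (wirtinger_contract (wirt_bar_wirtinger (0, delta_mx 0 j))
  (fun k => smooth_conj (eta_smooth k).1) Fs qD) _.
congr (_ + _); rewrite -[RHS](sum_delta (fun k => F k q)).
apply: eq_bigr => k _; have [_ _ _ ->] := wirt_eta (0, delta_mx 0 j) k qD.
by rewrite mxE; case: (_ && _); rewrite ?conjc1 ?conjc0.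
Qed.

Lemma wirt_sumv (I : Type) (r : seq I) (c : I -> R[i]) (v : I -> V * V) f q :
  smooth_on D f -> D q ->
  wirt (\sum_(i <- r) c i *: v i) f q = \sum_(i <- r) c i * wirt (v i) f q /\
  wirt_bar (\sum_(i <- r) c i *: v i) f q =
  \sum_(i <- r) conjc (c i) * wirt_bar (v i) f q.
Proof.
move=> fs qD; elim: r => [|i r [IH IHb]].
  rewrite !big_nil -(scale0r 0); have [-> ->] := wirtZv 0 0 fs qD.
  by rewrite mul0r conjc0 mul0r.
rewrite !big_cons; have [-> ->] := wirtDv (c i *: v i) (\sum_(i <- r) c i *: v i) fs qD.
by have [-> ->] := wirtZv (c i) (v i) fs qD; rewrite IH IHb.
Qed.

(** Rewrites the sums in Euler's relations as derivatives in the single direction eta, which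
    homogeneity controls. *)
Lemma wirt_radial f q : smooth_on D f -> D q ->
  wirt (0, q.2) f q = \sum_(k < n) q.2 0 k * deta k f q /\
  wirt_bar (0, q.2) f q = \sum_(k < n) conjc (q.2 0 k) * detab k f q.
Proof.
move=> fs qD; have [<- <-] := wirt_sumv (index_enum 'I_n) (fun k => q.2 0 k)
  (fun k => (0, delta_mx 0 k)) fs qD.
have -> // : \sum_(k < n) q.2 0 k *: (0, delta_mx 0 k) = (0, q.2) :> V * V.
apply/eqP; rewrite -pair_eqE /= (raddf_sum fst) (raddf_sum snd); apply/andP; split; apply/eqP.
  by rewrite big1// => k _ /=; rewrite scaler0.
exact/esym/row_sum_delta.
Qed.

End Wirtinger.

(** * Landsberg identities in a chart *)

Section LandsbergAlgebra.
Context {R : realType} {n : nat} (D : set ('rV[R[i]]_n * 'rV[R[i]]_n)).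
Context (L : 'rV[R[i]]_n * 'rV[R[i]]_n -> R[i]).
Hypothesis openD : open D.
Hypothesis L_smooth : smooth_on D L.
Hypothesis L_real : forall q, D q -> conjc (L q) = L q.
Hypothesis L_hom : forall q (c : R[i]), D q -> L (q.1, c *: q.2) = `|c| ^+ 2 * L q.
Hypothesis g_unit : forall q, D q -> gmx L q \in unitmx.
Local Notation V := 'rV[R[i]]_n.
Local Notation g := (gfund L).
Local Notation C := (cartan L).
Implicit Types (f : V * V -> R[i]) (q v w : V * V).

(** Meant for the directions eta and i eta, along which homogeneity makes [L] a real multiple [p t]
    of its value at [q]. *)
Lemma real_derive_scaling f v q (p : R -> R) (a : R) :
  (forall t : R, f (q + t%:C *: v) = (p t)%:C * f q) -> is_derive (0 : R) 1 p a ->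
  real_derive v f q = a%:C * f q.
Proof.
move=> fp pa.
have H (y : R) : is_derive (0 : R) 1 (fun t => p t * y) (a * y).
  apply: (is_derive_eq (is_deriveM pa (is_derive_cst y (0 : R) 1))).
  by rewrite scaler0 add0r /GRing.scale/= mulrC.
apply: complex_ext.
  rewrite ReZ_complex Re_real_derive; apply: (rderiveP _).2.
  under eq_fun do rewrite fp ReZ_complex.
  exact: H.
rewrite ImZ_complex Im_real_derive; apply: (rderiveP _).2.
under eq_fun do rewrite fp ImZ_complex.
exact: H.
Qed.

Lemma radial_derive q : D q ->
  real_derive (0, q.2) L q = 2%:C * L q /\
  real_derive ('i *: ((0 : V), q.2)) L q = 0.
Proof.
move=> qD; split.
  (* Moving by t eta scales eta by 1 + t, hence [L] by (1 + t)^2, whose derivative at 0 is 2. *)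
  apply: (@real_derive_scaling _ _ _ (fun t => (1 + t) * (1 + t))).
    move=> t; have -> : q + t%:C *: (0, q.2) = (q.1, (1 + t)%:C *: q.2).
      case: q {qD} => z e; congr pair; rewrite /= ?scaler0 ?addr0//.
      by rewrite rmorphD scalerDl scale1r.
    by rewrite L_hom// -add_Re2_Im2 /= expr0n addr0 expr2.
  have d : is_derive (0 : R) 1 (fun t : R => 1 + t) 1.
    apply: (is_derive_eq (is_deriveD (is_derive_cst (1 : R) (0 : R) 1) (is_derive_id (0 : R) 1))).
    by rewrite add0r.
  apply: (is_derive_eq (is_deriveM d d)).
  by rewrite addr0 /GRing.scale/= mulr1.
rewrite -[RHS](mul0r (L q)).
(* Moving by t i eta scales eta by 1 + i t, hence [L] by |1 + i t|^2 = 1 + t^2, which is stationary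
   at 0. *)
apply: (@real_derive_scaling _ _ _ (fun t => 1 + t * t) 0).
  move=> t; have -> : q + t%:C *: ('i *: (0, q.2)) = (q.1, (1 +i* t) *: q.2).
    case: q {qD} => z e; congr pair; rewrite /= ?scaler0 ?addr0//.
    rewrite scalerA -[X in X + _]scale1r -scalerDl -complexiE; congr (_ *: _).
    by apply: complex_ext; rewrite /=; ring.
  by rewrite L_hom// -add_Re2_Im2 /= expr1n expr2.
have d := is_derive_id (0 : R) 1.
apply: (is_derive_eq (is_deriveD (is_derive_cst (1 : R) (0 : R) 1) (is_deriveM d d))).
by rewrite !scale0r !addr0.
Qed.

Lemma euler q : D q -> \sum_(k < n) q.2 0 k * deta k L q = L q /\
  \sum_(k < n) conjc (q.2 0 k) * detab k L q = L q.
Proof.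
move=> qD; have [<- <-] := wirt_radial openD L_smooth qD.
rewrite /wirt /wirt_bar; have [-> ->] := radial_derive qD.
by rewrite mulr0 subr0 addr0 rmorph_nat mulKf ?pnatr_eq0.
Qed.

(* Otherwise unifying two different derivatives unfolds both of them down to
   limits of difference quotients. *)
Opaque wirt wirt_bar.

Let detaW k : wirtinger (deta k) := wirt_wirtinger (0 : V, delta_mx 0 k).
Let detabW k : wirtinger (detab k) := wirt_bar_wirtinger (0 : V, delta_mx 0 k).
Let dzW k : wirtinger (dz k) := wirt_wirtinger (delta_mx 0 k, 0 : V).

Lemma dL_smooth m : smooth_on D (detab m L).
Proof. exact: smooth_wirtinger. Qed.

Lemma gfund_smooth i m : smooth_on D (g i m).
Proof. by apply: smooth_wirtinger => //; exact: dL_smooth. Qed.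

Lemma cartan_smooth i m k : smooth_on D (C i m k).
Proof. by apply: smooth_wirtinger => //; exact: gfund_smooth. Qed.

Lemma ginv_smooth m i : smooth_on D (ginv L m i).
Proof.
apply: (smooth_invmx openD m i g_unit) => j k.
by apply: eq_smooth (gfund_smooth j k) => // q _; rewrite mxE.
Qed.

Lemma NCF_smooth i j : smooth_on D (NCF L i j).
Proof.
rewrite /NCF; apply: (smooth_sum openD) => l; apply: (smooth_sum openD) => m.
apply: (smoothM openD _ (eta_smooth D l).1).
apply: (smoothM openD (ginv_smooth m i)).
exact: (smooth_wirtinger openD (dzW j) (gfund_smooth l m)).
Qed.

Lemma spray_smooth i : smooth_on D (spray L i).
Proof.
rewrite /spray; apply: (smoothM openD (smooth_cst D _)); apply: (smooth_sum openD) => j.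
exact: (smoothM openD (NCF_smooth i j) (eta_smooth D j).1).
Qed.

Lemma Nc_smooth i j : smooth_on D (Nc L i j).
Proof. by apply: smooth_wirtinger => //; exact: spray_smooth. Qed.

Lemma LB_smooth i j k : smooth_on D (LB L i j k).
Proof. by apply: smooth_wirtinger => //; exact: Nc_smooth. Qed.

(** * Homogeneity of the metric, the spray and the connection coefficients *)

Lemma g_eta m q : D q -> \sum_(l < n) q.2 0 l * g l m q = detab m L q.
Proof.
move=> qD.
have E : {in D, L =1 fun x => \sum_(k < n) x.2 0 k * deta k L x}.
  by move=> x /[!inE] xD; have [-> _] := euler xD.
rewrite (eq_wirtinger openD (detabW m) qD E) (detab_contract openD)//; last first.
  by move=> k; exact: smooth_wirtinger.
by apply: eq_bigr => k _; rewrite (wirtingerC openD (detabW m) (detaW k) L_smooth qD).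
Qed.

Lemma cartanC i m k q : D q -> C i m k q = C k m i q.
Proof. by move=> qD; exact: (wirtingerC openD (detaW k) (detaW i) (dL_smooth m) qD). Qed.

(** The metric has degree 0 in eta: the eta^h-derivative of [g_eta] has [g h m] on both sides, and
    what remains is this contraction. *)
Lemma cartan_eta m h q : D q -> \sum_(l < n) q.2 0 l * C l m h q = 0.
Proof.
move=> qD; apply: (@addrI _ (g h m q)); rewrite addr0.
rewrite -(deta_contract openD h (fun k => gfund_smooth k m) qD).
apply: (eq_wirtinger openD (detaW h) qD) => x /[!inE] xD.
exact: g_eta.
Qed.

(** [detab m L] has degree 0 in conj eta: the conjugate Euler relation is differentiated in conj
    eta^m, and the free term cancels against the right-hand side. *)
Lemma etab_dL m q : D q ->
  \sum_(k < n) conjc (q.2 0 k) * detab k (detab m L) q = 0.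
Proof.
move=> qD; have S : \sum_(k < n) conjc (q.2 0 k) * detab m (detab k L) q = 0.
  apply: (@addrI _ (detab m L q)); rewrite addr0.
  apply: etrans (esym (detab_contractb openD m dL_smooth qD)) _.
  by apply: (eq_wirtinger openD (detabW m) qD) => x /[!inE] /euler[].
apply: etrans S; apply: eq_bigr => k _.
by rewrite (wirtingerC openD (detabW k) (detabW m) L_smooth qD).
Qed.

Lemma etab_dg l m q : D q ->
  \sum_(k < n) conjc (q.2 0 k) * detab k (g l m) q = 0.
Proof.
move=> qD.
have ddL k : smooth_on D (detab k (detab m L)).
  exact: (smooth_wirtinger openD (detabW k) (dL_smooth m)).
have S : \sum_(k < n) conjc (q.2 0 k) * deta l (detab k (detab m L)) q = 0.
  apply: etrans (esym (deta_contractb openD l ddL qD)) _.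
  apply: etrans (wirtinger_cst 0 q (detaW l)).
  by apply: (eq_wirtinger openD (detaW l) qD) => x /[!inE] xD; rewrite etab_dL.
apply: etrans S; apply: eq_bigr => k _.
by rewrite (wirtingerC openD (detaW l) (detabW k) (dL_smooth m) qD).
Qed.

(** The form in which nondegeneracy is used: an identity with an upper index follows from the one
    lowered by [g]. *)
Lemma g_cancel (x y : 'I_n -> R[i]) q : D q ->
  (forall m, \sum_(i < n) x i * g i m q = \sum_(i < n) y i * g i m q) -> x =1 y.
Proof.
move=> qD xy i.
have E (z : 'I_n -> R[i]) m :
    ((\row_i z i) *m gmx L q) 0 m = \sum_(i < n) z i * g i m q.
  by rewrite mxE; apply: eq_bigr => k _; rewrite !mxE.
have : (\row_i x i) *m gmx L q = (\row_i y i) *m gmx L q.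
  by apply/rowP => m; rewrite !E.
by move=> /(can_inj (mulmxK (g_unit qD)))/rowP/(_ i); rewrite !mxE.
Qed.

Lemma ginv_g l m q : D q -> \sum_(i < n) ginv L l i q * g i m q = (l == m)%:R.
Proof.
move=> qD; have /matrixP/(_ l m) := mulVmx (g_unit qD).
by rewrite !mxE => <-; apply: eq_bigr => i _; rewrite mxE.
Qed.

Lemma sum_ginv_g (F : 'I_n -> R[i]) m q : D q ->
  \sum_(i < n) (\sum_(l < n) ginv L l i q * F l) * g i m q = F m.
Proof.
move=> qD; under eq_bigr do rewrite mulr_suml.
rewrite exchange_big/= (bigD1 m)//= [X in _ + X]big1 ?addr0 => [|l lm].
  under eq_bigr do rewrite mulrAC.
  by rewrite -mulr_suml ginv_g// eqxx mul1r.
under eq_bigr do rewrite mulrAC.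
by rewrite -mulr_suml ginv_g// (negbTE lm) mul0r.
Qed.

Lemma NCF_g j m q : D q -> \sum_(i < n) NCF L i j q * g i m q = dz j (detab m L) q.
Proof.
move=> qD.
rewrite -(sum_ginv_g (fun l => dz j (detab l L) q) m qD); apply: eq_bigr => i _.
congr (_ * _); rewrite /NCF exchange_big/=; apply: eq_bigr => l _.
under eq_bigr do rewrite -mulrA.
rewrite -mulr_sumr; congr (_ * _).
transitivity (dz j (fun x => \sum_(k < n) x.2 0 k * g k l x) q).
  rewrite (dz_contract openD _ (fun k => gfund_smooth k l) qD).
  by apply: eq_bigr => k _; rewrite mulrC.
by apply: (eq_wirtinger openD (dzW j) qD) => x /[!inE] xD; rewrite g_eta.
Qed.

Lemma spray_g m q : D q -> \sum_(i < n) spray L i q * g i m q =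
  2^-1 * \sum_(j < n) q.2 0 j * dz j (detab m L) q.
Proof.
move=> qD.
have E i : spray L i q * g i m q = 2^-1 * \sum_(j < n) NCF L i j q * q.2 0 j * g i m q.
  by rewrite /spray -mulrA [X in _ * X = _]mulr_suml.
apply: etrans (eq_bigr _ (fun i _ => E i)) _.
rewrite -mulr_sumr exchange_big/=.
congr (_ * _).
apply: eq_bigr => j _.
rewrite -(NCF_g j m qD) mulr_sumr; apply: eq_bigr => i _.
by rewrite mulrA [X in X * _]mulrC.
Qed.

Lemma contract_sum (e : 'I_n -> R[i]) (A : 'I_n -> 'I_n -> R[i]) (T : 'I_n -> R[i]) :
  \sum_(k < n) e k * (\sum_(i < n) A i k * T i) =
  \sum_(i < n) (\sum_(k < n) e k * A i k) * T i.
Proof.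
under eq_bigr do rewrite mulr_sumr.
rewrite exchange_big; apply: eq_bigr => i _; rewrite mulr_suml.
by apply: eq_bigr => k _; rewrite mulrA.
Qed.

Lemma dz_dL_smooth j m : smooth_on D (dz j (detab m L)).
Proof. exact: (smooth_wirtinger openD (dzW j) (dL_smooth m)). Qed.

Lemma spray_g_smooth m :
  smooth_on D (fun x => \sum_(j < n) x.2 0 j * dz j (detab m L) x).
Proof.
by apply: (smooth_sum openD) => j;
   exact: (smoothM openD (eta_smooth D j).1 (dz_dL_smooth j m)).
Qed.

Lemma dz_g_smooth j k m : smooth_on D (dz j (g k m)).
Proof. exact: (smooth_wirtinger openD (dzW j) (gfund_smooth k m)). Qed.

(** The eta^k-derivative of [spray_g]; the Cartan term comes from differentiating the lowering
    factor. *)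
Lemma Nc_g k m q : D q ->
  \sum_(i < n) Nc L i k q * g i m q + \sum_(i < n) spray L i q * C i m k q =
  2^-1 * (dz k (detab m L) q + \sum_(j < n) q.2 0 j * dz j (g k m) q).
Proof.
move=> qD.
apply: etrans (esym (wirtinger_contract openD (detaW k) spray_smooth
  (fun i => gfund_smooth i m) qD)) _.
transitivity (deta k (fun x => 2^-1 * \sum_(j < n) x.2 0 j * dz j (detab m L) x) q).
  by apply: (eq_wirtinger openD (detaW k) qD) => x /[!inE] xD; exact: spray_g.
apply: etrans (wirtingerZ openD 2^-1 (detaW k) (spray_g_smooth m) qD) _.
apply: (congr1 ( *%R 2^-1)).
apply: etrans (deta_contract openD k (fun j => dz_dL_smooth j m) qD) _.
apply: (congr1 (+%R _)); apply: eq_bigr => j _.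
by rewrite (wirtingerC openD (detaW k) (dzW j) (dL_smooth m) qD).
Qed.

Lemma eta_dz_g j m q : D q ->
  \sum_(k < n) q.2 0 k * dz j (g k m) q = dz j (detab m L) q.
Proof.
move=> qD; apply: etrans (esym (dz_contract openD j (fun k => gfund_smooth k m) qD)) _.
by apply: (eq_wirtinger openD (dzW j) qD) => x /[!inE] xD; exact: g_eta.
Qed.

(** Euler's relation for the spray, of degree 2 in eta. It comes from contracting [Nc_g]: the Cartan
    term vanishes by [cartan_eta], and the two terms on the right become equal. *)
Lemma eta_Nc i q : D q -> \sum_(k < n) q.2 0 k * Nc L i k q = 2 * spray L i q.
Proof.
move=> qD; move: i; apply: (g_cancel qD) => m.
have -> : \sum_(i < n) 2 * spray L i q * g i m q = 2 * \sum_(i < n) spray L i q * g i m q.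
  by rewrite mulr_sumr; apply: eq_bigr => i _; rewrite mulrA.
have -> : \sum_(i < n) (\sum_(k < n) q.2 0 k * Nc L i k q) * g i m q =
    \sum_(k < n) q.2 0 k * (\sum_(i < n) Nc L i k q * g i m q).
  by symmetry; exact: (contract_sum _ (fun i k => Nc L i k q)).
have E k : \sum_(i < n) Nc L i k q * g i m q =
    2^-1 * (dz k (detab m L) q + \sum_(j < n) q.2 0 j * dz j (g k m) q)
    - \sum_(i < n) spray L i q * C i m k q.
  by rewrite -Nc_g// addrK.
have EC : \sum_(k < n) q.2 0 k * (\sum_(i < n) spray L i q * C i m k q) = 0.
  under eq_bigr do rewrite mulr_sumr.
  rewrite exchange_big/= big1// => i _.
  transitivity (spray L i q * \sum_(k < n) q.2 0 k * C k m i q); last first.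
    by rewrite cartan_eta// mulr0.
  rewrite mulr_sumr.
  by apply: eq_bigr => k _; rewrite mulrCA (cartanC _ _ _ qD).
have EZ : \sum_(k < n) q.2 0 k * (\sum_(j < n) q.2 0 j * dz j (g k m) q) =
    \sum_(j < n) q.2 0 j * dz j (detab m L) q.
  under eq_bigr do rewrite mulr_sumr.
  rewrite exchange_big/=; apply: eq_bigr => j _.
  by rewrite -(eta_dz_g j m qD) mulr_sumr; apply: eq_bigr => k _; rewrite mulrCA.
rewrite (spray_g m qD) mulVKf ?pnatr_eq0//.
under eq_bigr do rewrite E mulrBr mulrCA mulrDr.
rewrite sumrB EC subr0 -mulr_sumr big_split/= EZ.
by rewrite -mulr2n -[X in _ * X]mulr_natl mulKf ?pnatr_eq0.
Qed.

(** The spray has degree 0 in conj eta. In the conj eta^k-derivative of [spray_g], contracted with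
    conj eta^k, all other terms contain the conjugate radial derivative of [detab m L] or of [g],
    and these vanish by [etab_dL] and [etab_dg]. *)
Lemma etab_spray i q : D q -> \sum_(k < n) conjc (q.2 0 k) * detab k (spray L i) q = 0.
Proof.
move=> qD; move: i; apply: (g_cancel qD) => m.
rewrite [RHS]big1; last by move=> i _; rewrite mul0r.
have -> : \sum_(i < n) (\sum_(k < n) conjc (q.2 0 k) * detab k (spray L i) q) * g i m q =
    \sum_(k < n) conjc (q.2 0 k) * (\sum_(i < n) detab k (spray L i) q * g i m q).
  by symmetry; exact: (contract_sum _ (fun i k => detab k (spray L i) q)).
have E k : \sum_(i < n) detab k (spray L i) q * g i m q =
    2^-1 * (\sum_(j < n) q.2 0 j * dz j (detab k (detab m L)) q)
    - \sum_(i < n) spray L i q * detab k (g i m) q.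
  apply: (canRL (addrK _)).
  apply: etrans (esym (wirtinger_contract openD (detabW k) spray_smooth
    (fun i => gfund_smooth i m) qD)) _.
  transitivity (detab k (fun x => 2^-1 * \sum_(j < n) x.2 0 j * dz j (detab m L) x) q).
    by apply: (eq_wirtinger openD (detabW k) qD) => x /[!inE] xD; exact: spray_g.
  apply: etrans (wirtingerZ openD 2^-1 (detabW k) (spray_g_smooth m) qD) _.
  apply: (congr1 ( *%R 2^-1)).
  apply: etrans (detab_contract openD k (fun j => dz_dL_smooth j m) qD) _.
  apply: eq_bigr => j _.
  by rewrite (wirtingerC openD (detabW k) (dzW j) (dL_smooth m) qD).
have EC : \sum_(k < n) conjc (q.2 0 k) * (\sum_(i < n) spray L i q * detab k (g i m) q) = 0.
  under eq_bigr do rewrite mulr_sumr.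
  rewrite exchange_big/= big1// => i _.
  transitivity (spray L i q * \sum_(k < n) conjc (q.2 0 k) * detab k (g i m) q); last first.
    by rewrite etab_dg// mulr0.
  rewrite mulr_sumr.
  by apply: eq_bigr => k _; rewrite mulrCA.
have EZ : \sum_(k < n) conjc (q.2 0 k) *
    (\sum_(j < n) q.2 0 j * dz j (detab k (detab m L)) q) = 0.
  under eq_bigr do rewrite mulr_sumr.
  rewrite exchange_big/= big1// => j _.
  have ddL k : smooth_on D (detab k (detab m L)).
    exact: (smooth_wirtinger openD (detabW k) (dL_smooth m)).
  have S : \sum_(k < n) conjc (q.2 0 k) * dz j (detab k (detab m L)) q = 0.
    apply: etrans (esym (dz_contractb openD j ddL qD)) _.
    apply: etrans (wirtinger_cst 0 q (dzW j)).
    by apply: (eq_wirtinger openD (dzW j) qD) => x /[!inE] xD; rewrite etab_dL.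
  transitivity (q.2 0 j *
      \sum_(k < n) conjc (q.2 0 k) * dz j (detab k (detab m L)) q); last first.
    by rewrite S mulr0.
  rewrite mulr_sumr.
  by apply: eq_bigr => k _; rewrite mulrCA.
under eq_bigr do rewrite E mulrBr mulrCA.
by rewrite sumrB EC subr0 -mulr_sumr EZ mulr0.
Qed.

Lemma LB_barE m r k q : LB_bar L m r k q = conjc (LB_b L m r k q).
Proof. by []. Qed.

(** Up to conjugation this is the eta^r-derivative of [etab_spray], since [deta] does not act on
    conj eta. It removes the barred Berwald terms whenever the derivative index is contracted. *)
Lemma LB_bar_eta m r q : D q -> \sum_(k < n) q.2 0 k * LB_bar L m r k q = 0.
Proof.
move=> qD.
have ds k : smooth_on D (detab k (spray L m)).
  exact: (smooth_wirtinger openD (detabW k) (spray_smooth m)).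
have S : \sum_(k < n) conjc (q.2 0 k) * LB_b L m r k q = 0.
  have S' : \sum_(k < n) conjc (q.2 0 k) * deta r (detab k (spray L m)) q = 0.
    apply: etrans (esym (deta_contractb openD r ds qD)) _.
    apply: etrans (wirtinger_cst 0 q (detaW r)).
    by apply: (eq_wirtinger openD (detaW r) qD) => x /[!inE] xD; rewrite etab_spray.
  apply: etrans S'; apply: eq_bigr => k _.
  by rewrite (wirtingerC openD (detaW r) (detabW k) (spray_smooth m) qD).
apply: etrans (_ : conjc (\sum_(k < n) conjc (q.2 0 k) * LB_b L m r k q) = 0); last first.
  by rewrite S conjc0.
rewrite rmorph_sum; apply: eq_bigr => k _.
rewrite LB_barE -[in LHS](conjcK (q.2 0 k)); symmetry.
exact: (rmorphM _ (conjc (q.2 0 k)) (LB_b L m r k q)).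
Qed.

Lemma LBC i j k q : D q -> LB L i j k q = LB L i k j q.
Proof. by move=> qD; exact: (wirtingerC openD (detaW k) (detaW j) (spray_smooth i) qD). Qed.

(** Differentiating [eta_Nc] in eta^j gives N plus this contraction on the left and 2N on the
    right. *)
Lemma eta_LB i j q : D q -> \sum_(k < n) q.2 0 k * LB L i j k q = Nc L i j q.
Proof.
move=> qD; apply: (@addrI _ (Nc L i j q)).
transitivity (deta j (fun x => 2 * spray L i x) q); last first.
  rewrite (wirtingerZ openD 2 (detaW j) (spray_smooth i) qD).
  by rewrite mulr_natl mulr2n.
apply: etrans (_ : deta j (fun x => \sum_(k < n) x.2 0 k * Nc L i k x) q = _).
  apply: etrans (esym (deta_contract openD j (fun k => Nc_smooth i k) qD)).
  by apply: (congr1 (+%R _)); apply: eq_bigr => k _; rewrite LBC.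
by apply: (eq_wirtinger openD (detaW j) qD) => x /[!inE] xD; rewrite eta_Nc.
Qed.

Lemma LB_g k h m q : D q ->
  \sum_(i < n) LB L i k h q * g i m q + \sum_(i < n) Nc L i k q * C i m h q
  + (\sum_(i < n) Nc L i h q * C i m k q + \sum_(i < n) spray L i q * deta h (C i m k) q)
  = 2^-1 * (dz k (g h m) q + (dz h (g k m) q + \sum_(j < n) q.2 0 j * dz j (C k m h) q)).
Proof.
move=> qD.
have s1 : smooth_on D (fun x => \sum_(i < n) Nc L i k x * g i m x).
  by apply: (smooth_sum openD) => i; exact: (smoothM openD (Nc_smooth i k) (gfund_smooth i m)).
have s2 : smooth_on D (fun x => \sum_(i < n) spray L i x * C i m k x).
  by apply: (smooth_sum openD) => i;
     exact: (smoothM openD (spray_smooth i) (cartan_smooth i m k)).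
have s3 : smooth_on D (fun x => \sum_(j < n) x.2 0 j * dz j (g k m) x).
  by apply: (smooth_sum openD) => j;
     exact: (smoothM openD (eta_smooth D j).1 (dz_g_smooth j k m)).
have e1 := wirtinger_contract openD (detaW h) (fun i => Nc_smooth i k)
  (fun i => gfund_smooth i m) qD.
have e2 := wirtinger_contract openD (detaW h) spray_smooth
  (fun i => cartan_smooth i m k) qD.
apply: etrans (esym (congr2 +%R e1 e2)) _.
apply: etrans (esym (wirtingerD openD (detaW h) s1 s2 qD)) _.
transitivity (deta h (fun x => 2^-1 *
  (dz k (detab m L) x + \sum_(j < n) x.2 0 j * dz j (g k m) x)) q).
  by apply: (eq_wirtinger openD (detaW h) qD) => x /[!inE] xD; exact: Nc_g.
apply: etrans (wirtingerZ openD 2^-1 (detaW h) (smoothD openD (dz_dL_smooth k m) s3) qD) _.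
apply: (congr1 ( *%R 2^-1)).
apply: etrans (wirtingerD openD (detaW h) (dz_dL_smooth k m) s3 qD) _.
apply: (congr2 +%R).
  exact: (wirtingerC openD (detaW h) (dzW k) (dL_smooth m) qD).
apply: etrans (deta_contract openD h (fun j => dz_g_smooth j k m) qD) _.
apply: (congr1 (+%R _)); apply: eq_bigr => j _.
by rewrite (wirtingerC openD (detaW h) (dzW j) (gfund_smooth k m) qD).
Qed.

(** * Comparison of the Berwald and Rund coefficients *)

Lemma LR_g i j m q : D q -> \sum_(l < n) LR L l i j q * g l m q =
  2^-1 * (delta_c L j (g i m) q + delta_c L i (g j m) q).
Proof.
move=> qD; rewrite -(sum_ginv_g (fun l => delta_c L j (g i l) q + delta_c L i (g j l) q) m qD).
rewrite mulr_sumr; apply: eq_bigr => l _; rewrite [RHS]mulrA.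
by rewrite /LR.
Qed.

(** Homogeneity eliminates every connection coefficient of second order: the factor 2 with the spray
    comes from [eta_Nc], the N terms from [eta_LB], and the barred term is zero by [LB_bar_eta]. *)
Lemma hcov3_eta l r h q : D q ->
  \sum_(k < n) hcov3 L C l r h k q * q.2 0 k =
  \sum_(j < n) q.2 0 j * dz j (C l r h) q
  - 2 * \sum_(i < n) spray L i q * deta i (C l r h) q
  - \sum_(i < n) Nc L i l q * C i r h q - \sum_(i < n) Nc L i h q * C l r i q.
Proof.
move=> qD.
transitivity (\sum_(k < n) q.2 0 k * dz k (C l r h) q
   - \sum_(k < n) q.2 0 k * (\sum_(i < n) Nc L i k q * deta i (C l r h) q)
   - \sum_(k < n) q.2 0 k * (\sum_(i < n) LB L i l k q * C i r h q)
   - \sum_(k < n) q.2 0 k * (\sum_(i < n) LB_bar L i r k q * C l i h q)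
   - \sum_(k < n) q.2 0 k * (\sum_(i < n) LB L i h k q * C l r i q)).
  by rewrite -!sumrB; apply: eq_bigr => k _; rewrite /hcov3 /delta_c mulrC !mulrBr.
have cs := contract_sum (fun k => q.2 0 k).
have sub4 (t a b c d a' b' d' : R[i]) : a = a' -> b = b' -> c = 0 -> d = d' ->
  t - a - b - c - d = t - a' - b' - d' by move=> -> -> -> ->; rewrite subr0.
apply: sub4.
- apply: etrans (cs (fun i k => Nc L i k q) (fun i => deta i (C l r h) q)) _.
  by rewrite mulr_sumr; apply: eq_bigr => i _; rewrite eta_Nc// mulrA.
- apply: etrans (cs (fun i k => LB L i l k q) (fun i => C i r h q)) _.
  by apply: eq_bigr => i _; rewrite eta_LB.
- apply: etrans (cs (fun i k => LB_bar L i r k q) (fun i => C l i h q)) _.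
  by apply: big1 => i _; rewrite LB_bar_eta// mul0r.
apply: etrans (cs (fun i k => LB L i h k q) (fun i => C l r i q)) _.
by apply: eq_bigr => i _; rewrite eta_LB.
Qed.

(* The second derivative of the spray equation 2 G^i g_{i mb} =
   eta^j d_{z^j} detab_m L in eta^k, eta^h. *)
Lemma landsberg_g k h m q : D q ->
  2 * \sum_(i < n) (LB L i k h q - LR L i k h q) * g i m q =
  \sum_(j < n) hcov3 L C k m h j q * q.2 0 j.
Proof.
move=> qD; apply: etrans (esym (hcov3_eta k m h qD)).
have AE : \sum_(i < n) (LB L i k h q - LR L i k h q) * g i m q =
    \sum_(i < n) LB L i k h q * g i m q - \sum_(i < n) LR L i k h q * g i m q.
  by rewrite -sumrB; apply: eq_bigr => i _; rewrite mulrBl.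
have dE a b : delta_c L a (g b m) q = dz a (g b m) q - \sum_(i < n) Nc L i a q * C i m b q.
  apply: (congr1 (fun x => _ - x)); apply: eq_bigr => i _.
  by rewrite -(cartanC b m i qD).
(* The third eta-derivatives of [detab m L] are symmetric, so the outer index can be exchanged with
   a Cartan index. *)
have sE : \sum_(i < n) spray L i q * deta h (C i m k) q =
    \sum_(i < n) spray L i q * deta i (C k m h) q.
  apply: eq_bigr => i _; apply: (congr1 ( *%R _)).
  transitivity (deta h (deta i (g k m)) q).
    by apply: (eq_wirtinger openD (detaW h) qD) => x /[!inE] xD; exact: cartanC.
  exact: (wirtingerC openD (detaW h) (detaW i) (gfund_smooth k m) qD).
have cE : \sum_(i < n) Nc L i h q * C k m i q = \sum_(i < n) Nc L i h q * C i m k q.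
  by apply: eq_bigr => i _; rewrite (cartanC k m i qD).
have h2 : 2 * 2^-1 = 1 :> R[i] by rewrite mulfV ?pnatr_eq0.
(* In twice the difference of [LB_g] and [LR_g] the z-derivatives of [g] cancel and one copy of each
   N C sum survives; these are the terms of [hcov3_eta]. *)
have lin (A B P S S' Z B1 B2 B2' d1 d2 z1 z2 : R[i]) : P = A - B ->
    A + B1 + (B2 + S) = 2^-1 * (z2 + (z1 + Z)) -> B = 2^-1 * (d1 + d2) ->
    d1 = z1 - B2 -> d2 = z2 - B1 -> S = S' -> B2' = B2 ->
    2 * P = Z - 2 * S' - B1 - B2'.
  move=> -> E -> -> -> <- ->.
  have -> : A = 2^-1 * (z2 + (z1 + Z)) - (B2 + S) - B1 by rewrite -E !addrK.
  by ring: h2.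
exact: (lin _ _ _ _ _ _ _ _ _ _ _ _ _ AE (LB_g k h m qD) (LR_g k h m qD)
  (dE h k) (dE k h) sE cE).
Qed.

(** * Hermitian symmetry and the conditions ii), iii), iv) *)

Lemma gfund_conj i m q : D q -> conjc (g i m q) = g m i q.
Proof.
move=> qD.
have dLb : {in D, (fun x => conjc (detab m L x)) =1 deta m L}.
  move=> x /[!inE] xD; apply: etrans (wirt_conj openD _ L_smooth xD) _.
  by apply: (eq_wirtinger openD (detaW m) xD) => y /[!inE] yD; exact: L_real.
have E := wirt_conj openD (0, delta_mx 0 i) (smooth_conj openD (dL_smooth m)) qD.
(* [wirt_conj] produces an unbarred operator from a barred one; the double conjugate makes it
   applicable to [deta i], read from right to left. *)
have K : {in D, (fun x => conjc (conjc (detab m L x))) =1 detab m L}.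
  by move=> x _; exact: conjcK.
rewrite -[g i m q](eq_wirtinger openD (detaW i) qD K) -[deta i _ q]E conjcK.
apply: etrans (eq_wirtinger openD (detabW i) qD dLb) _.
exact: (wirtingerC openD (detabW i) (detaW m) L_smooth qD).
Qed.

Lemma delta_cb_g k j i q : D q ->
  conjc (delta_cb L k (g j i) q) = delta_c L k (g i j) q.
Proof.
move=> qD.
have K : {in D, (fun x => conjc (g j i x)) =1 g i j}.
  by move=> x /[!inE] xD; exact: gfund_conj.
have conj_wirt_bar v : conjc (wirt_bar v (g j i) q) = wirt v (g i j) q.
  apply: etrans (wirt_conj openD v (gfund_smooth j i) qD) _.
  exact: (eq_wirtinger openD (wirt_wirtinger v) qD K).
have cB (x y : R[i]) : conjc (x - y) = conjc x - conjc y := rmorphB _ x y.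
have cM (x y : R[i]) : conjc (conjc x * y) = x * conjc y.
  by apply: etrans (rmorphM _ _ _) _; rewrite /= conjcK.
apply: etrans (cB _ _) _; apply: (congr2 (fun x y => x - y)).
  exact: conj_wirt_bar.
apply: etrans (rmorph_sum _ _ _ _) _; apply: eq_bigr => l _.
apply: etrans (cM _ _) _; apply: (congr1 ( *%R _)).
exact: conj_wirt_bar.
Qed.

Lemma LR_bar_g i j k q : D q -> \sum_(m < n) LR_bar L m j k q * g i m q =
  2^-1 * (delta_c L k (g i j) q - delta_c L i (g k j) q).
Proof.
move=> qD.
have E : \sum_(m < n) LR_b L m j k q * g m i q =
    2^-1 * (delta_cb L k (g j i) q - delta_cb L i (g j k) q).
  rewrite -(sum_ginv_g (fun l => delta_cb L k (g j l) q - delta_cb L l (g j k) q) i qD).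
  rewrite mulr_sumr; apply: eq_bigr => m _; rewrite [RHS]mulrA.
  by rewrite /LR_b.
have cB (x y : R[i]) : conjc (x - y) = conjc x - conjc y := rmorphB _ x y.
have cM (x y : R[i]) : conjc (x * y) = conjc x * conjc y := rmorphM _ x y.
have cV : conjc (2^-1 : R[i]) = 2^-1 by rewrite conjc_inv conjc_nat.
transitivity (conjc (\sum_(m < n) LR_b L m j k q * g m i q)).
  symmetry; apply: etrans (rmorph_sum _ _ _ _) _; apply: eq_bigr => m _.
  by apply: etrans (cM _ _) _; apply: (congr1 ( *%R _)); exact: gfund_conj.
rewrite {}E; apply: etrans (cM _ _) _; apply: (congr2 *%R cV).
by apply: etrans (cB _ _) _; apply: (congr2 (fun x y => x - y)); exact: delta_cb_g.
Qed.

Lemma landsberg_metric q : D q ->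
  (forall i j k, LB L i j k q = LR L i j k q) <->
  (forall i j k, hcov2 L g i j k q =
    \sum_(m < n) (LR_bar L m j k q - LB_bar L m j k q) * g i m q).
Proof.
move=> qD.
have rhsE i j k : \sum_(m < n) (LR_bar L m j k q - LB_bar L m j k q) * g i m q =
   2^-1 * (delta_c L k (g i j) q - delta_c L i (g k j) q)
   - \sum_(m < n) LB_bar L m j k q * g i m q.
  apply: etrans (congr1 (fun x => x - _) (LR_bar_g i j k qD)); rewrite -sumrB.
  by apply: eq_bigr => m _; rewrite mulrBl.
have h2 : 2 * 2^-1 = 1 :> R[i] by rewrite mulfV ?pnatr_eq0.
have lin (a b S T S' : R[i]) : S' = 2^-1 * (a + b) ->
    (S = S' <-> a - S - T = 2^-1 * (a - b) - T).
  have ab : 2^-1 * (a - b) = a - 2^-1 * (a + b) by field.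
  move=> ->; rewrite ab; split=> [->//|].
  by move=> /(addIr (- T)) /(addrI a) /oppr_inj.
have E i j k := lin (delta_c L k (g i j) q) (delta_c L i (g k j) q)
  (\sum_(l < n) LB L l i k q * g l j q)
  (\sum_(m < n) LB_bar L m j k q * g i m q)
  (\sum_(l < n) LR L l i k q * g l j q) (LR_g i k j qD).
split=> H i j k.
  apply: etrans (esym (rhsE i j k)); apply: (iffLR (E i j k)).
  by apply: eq_bigr => l _; rewrite H.
move: i; apply: (g_cancel qD) => m; apply: (iffRL (E j m k)).
exact: etrans (H j m k) (rhsE j m k).
Qed.

Lemma landsberg_cartan q : D q ->
  (forall i j k, LB L i j k q = LR L i j k q) <->
  (forall l r h, \sum_(k < n) hcov3 L C l r h k q * q.2 0 k = 0).
Proof.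
move=> qD; split=> [H l r h|H i j k].
  rewrite -(landsberg_g l h r qD) big1 ?mulr0// => i _.
  by rewrite H subrr mul0r.
move: i; apply: (g_cancel qD) => m; apply/eqP; rewrite -subr_eq0; apply/eqP.
have n2 : (2 : R[i]) != 0 by rewrite pnatr_eq0.
apply: (mulfI n2); rewrite mulr0; apply: etrans (H j m k).
apply: etrans (landsberg_g j k m qD); apply: (congr1 ( *%R 2)).
by rewrite -sumrB; apply: eq_bigr => i _; rewrite mulrBl.
Qed.

(** Here a Cartan index is contracted, not the direction of differentiation. The sum vanishes
    because eta is parallel: differentiating eta^k C_{krh} = 0 leaves a term N C, which the Berwald
    correction of the index k compensates since eta^k L^i_{kj} = N^i_j. *)
Lemma hcov3_eta_first j r h q : D q ->
  \sum_(k < n) hcov3 L C k r h j q * q.2 0 k = 0.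
Proof.
move=> qD.
transitivity (\sum_(k < n) q.2 0 k * dz j (C k r h) q
   - \sum_(k < n) q.2 0 k * (\sum_(i < n) Nc L i j q * deta i (C k r h) q)
   - \sum_(k < n) q.2 0 k * (\sum_(i < n) LB L i k j q * C i r h q)
   - \sum_(k < n) q.2 0 k * (\sum_(m < n) LB_bar L m r j q * C k m h q)
   - \sum_(k < n) q.2 0 k * (\sum_(i < n) LB L i h j q * C k r i q)).
  by rewrite -!sumrB; apply: eq_bigr => k _; rewrite /hcov3 /delta_c mulrC !mulrBr.
have swap (a : 'I_n -> R[i]) (T : 'I_n -> 'I_n -> R[i]) :
    \sum_(k < n) q.2 0 k * (\sum_(i < n) a i * T i k) =
    \sum_(i < n) a i * (\sum_(k < n) q.2 0 k * T i k).
  under eq_bigr do rewrite mulr_sumr; under [RHS]eq_bigr do rewrite mulr_sumr.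
  by rewrite exchange_big; do 2 ![apply: eq_bigr => ? _]; rewrite mulrCA.
have C0 : {in D, (fun x : V * V => \sum_(k < n) x.2 0 k * C k r h x) =1 fun _ => 0}.
  by move=> x /[!inE] xD; exact: cartan_eta.
have Cs k := cartan_smooth k r h.
have e1 : \sum_(k < n) q.2 0 k * dz j (C k r h) q = 0.
  apply: etrans (esym (dz_contract openD j Cs qD)) _.
  apply: etrans (wirtinger_cst 0 q (dzW j)).
  exact: (eq_wirtinger openD (dzW j) qD C0).
have e2 i : \sum_(k < n) q.2 0 k * deta i (C k r h) q = - C i r h q.
  apply: (@addrI _ (C i r h q)); rewrite subrr.
  apply: etrans (esym (deta_contract openD i Cs qD)) _.
  apply: etrans (wirtinger_cst 0 q (detaW i)).
  exact: (eq_wirtinger openD (detaW i) qD C0).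
have sub5 (a b c d e x : R[i]) : a = 0 -> b = - x -> c = x -> d = 0 -> e = 0 ->
  a - b - c - d - e = 0.
  by move=> -> -> -> -> ->; ring.
apply: (sub5 _ _ _ _ _ (\sum_(i < n) Nc L i j q * C i r h q) e1).
- apply: etrans (swap (fun i => Nc L i j q) (fun i k => deta i (C k r h) q)) _.
  by rewrite -sumrN; apply: eq_bigr => i _; rewrite e2 mulrN.
- apply: etrans (contract_sum _ (fun i k => LB L i k j q) (fun i => C i r h q)) _.
  apply: eq_bigr => i _; apply: (congr1 (fun x => x * _)).
  by apply: etrans (eta_LB i j qD); apply: eq_bigr => k _; rewrite (LBC i k j qD).
- apply: etrans (swap (fun m => LB_bar L m r j q) (fun m k => C k m h q)) _.
  by apply: big1 => m _; rewrite cartan_eta// mulr0.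
apply: etrans (swap (fun i => LB L i h j q) (fun i k => C k r i q)) _.
by apply: big1 => m _; rewrite cartan_eta// mulr0.
Qed.

(** Differentiating [eta_LB] in eta^h gives the same Berwald coefficient on both sides: it has
    degree 0 in eta, and [LBC] would let either lower index be contracted. *)
Lemma eta_deta_LB h i j q : D q -> \sum_(k < n) q.2 0 k * deta h (LB L i j k) q = 0.
Proof.
move=> qD; apply: (@addrI _ (LB L i j h q)); rewrite addr0.
apply: etrans (esym (deta_contract openD h (fun k => LB_smooth i j k) qD)) _.
by apply: (eq_wirtinger openD (detaW h) qD) => x /[!inE] xD; exact: eta_LB.
Qed.

Lemma cartan_of_symmetrized q : D q ->
  (forall j k r h, 2 * \sum_(i < n) deta h (LB L i j k) q * g i r q
     - \sum_(m < n) LB_bar L m r k q * C j m h q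
     - \sum_(m < n) LB_bar L m r j q * C k m h q
   = hcov3 L C j r h k q + hcov3 L C k r h j q) ->
  forall l r h, \sum_(k < n) hcov3 L C l r h k q * q.2 0 k = 0.
Proof.
move=> qD H l r h; apply: etrans (esym (addr0 _)) _.
(* Adding this vanishing contraction completes the sum to the right-hand side of iii) contracted
   with eta^k. *)
apply: etrans (congr1 (+%R _) (esym (hcov3_eta_first l r h qD))) _.
rewrite -big_split /=.
transitivity (2 * (\sum_(k < n) q.2 0 k * (\sum_(i < n) deta h (LB L i l k) q * g i r q))
     - \sum_(k < n) q.2 0 k * (\sum_(m < n) LB_bar L m r k q * C l m h q)
     - \sum_(k < n) q.2 0 k * (\sum_(m < n) LB_bar L m r l q * C k m h q)).
  rewrite mulr_sumr -!sumrB; apply: eq_bigr => k _.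
  apply: etrans (esym (mulrDl _ _ _)) _.
  apply: etrans (congr1 (fun x => x * _) (esym (H l k r h))) _.
  by rewrite mulrC !mulrBr; apply: (congr1 (fun x => x - _ - _)); rewrite mulrCA.
have sub3 (a b c : R[i]) : a = 0 -> b = 0 -> c = 0 -> 2 * a - b - c = 0.
  by move=> -> -> ->; rewrite mulr0 !subr0.
apply: sub3.
- apply: etrans (contract_sum _ (fun i k => deta h (LB L i l k) q) (fun i => g i r q)) _.
  by apply: big1 => i _; rewrite eta_deta_LB// mul0r.
- apply: etrans (contract_sum _ (fun m k => LB_bar L m r k q) (fun m => C l m h q)) _.
  by apply: big1 => i _; rewrite LB_bar_eta// mul0r.
under eq_bigr do rewrite mulr_sumr.
rewrite exchange_big/=; apply: big1 => m _.
transitivity (LB_bar L m r l q * \sum_(k < n) q.2 0 k * C k m h q).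
  by rewrite mulr_sumr; apply: eq_bigr => k _; rewrite mulrCA.
by rewrite cartan_eta// mulr0.
Qed.

Lemma delta_c_smooth k f : smooth_on D f -> smooth_on D (delta_c L k f).
Proof.
move=> fs; apply: (smoothB openD (smooth_wirtinger openD (dzW k) fs)).
apply: (smooth_sum openD) => i; apply: (smoothM openD (Nc_smooth i k)).
exact: (smooth_wirtinger openD (detaW i) fs).
Qed.

(** The bracket of vertical and horizontal derivations: the coordinate derivatives commute, so only
    the eta-dependence of N contributes, and its eta^h-derivative is the Berwald coefficient. *)
Lemma deta_delta_c h k f q : smooth_on D f -> D q ->
  deta h (delta_c L k f) q =
  delta_c L k (deta h f) q - \sum_(i < n) LB L i k h q * deta i f q.
Proof.
move=> fs qD.
have ds i := smooth_wirtinger openD (detaW i) fs.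
have ss : smooth_on D (fun x => \sum_(i < n) Nc L i k x * deta i f x).
  by apply: (smooth_sum openD) => i; exact: (smoothM openD (Nc_smooth i k) (ds i)).
transitivity (deta h (dz k f) q - deta h (fun x => \sum_(i < n) Nc L i k x * deta i f x) q).
  apply: etrans (wirtingerD openD (detaW h) (smooth_wirtinger openD (dzW k) fs)
    (smoothN openD ss) qD) _.
  apply: (congr1 (+%R _)).
  transitivity (deta h (fun x => -1 * (\sum_(i < n) Nc L i k x * deta i f x)) q).
    by apply: (eq_wirtinger openD (detaW h) qD) => x _; rewrite mulN1r.
  by apply: etrans (wirtingerZ openD (-1) (detaW h) ss qD) _; rewrite mulN1r.
have e1 := wirtinger_contract openD (detaW h) (fun i => Nc_smooth i k) ds qD.
have e2 := wirtingerC openD (detaW h) (dzW k) fs qD.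
have e3 : \sum_(i < n) Nc L i k q * deta h (deta i f) q =
    \sum_(i < n) Nc L i k q * deta i (deta h f) q.
  apply: eq_bigr => i _; apply: (congr1 ( *%R _)).
  exact: (wirtingerC openD (detaW h) (detaW i) fs qD).
have lin (a a' b s t t' : R[i]) : a = a' -> b = s + t -> t = t' -> a - b = a' - t' - s.
  by move=> -> -> ->; ring.
exact: (lin _ _ _ _ _ _ e2 e1 e3).
Qed.

(** Condition i) is assumed on all of [D] because its lowered form is differentiated in eta^h. The
    brackets from [deta_delta_c] supply the Berwald corrections for the index h. *)
Lemma landsberg_symmetrized : (forall q, D q -> forall i j k, LB L i j k q = LR L i j k q) ->
  forall q, D q -> forall j k r h,
   2 * \sum_(i < n) deta h (LB L i j k) q * g i r q
     - \sum_(m < n) LB_bar L m r k q * C j m h q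
     - \sum_(m < n) LB_bar L m r j q * C k m h q
   = hcov3 L C j r h k q + hcov3 L C k r h j q.
Proof.
move=> H q qD j k r h.
have dgs a b : smooth_on D (delta_c L a (g b r)).
  exact: (delta_c_smooth a (gfund_smooth b r)).
have E : \sum_(i < n) deta h (LB L i j k) q * g i r q
    + \sum_(i < n) LB L i j k q * C i r h q =
    2^-1 * (deta h (delta_c L k (g j r)) q + deta h (delta_c L j (g k r)) q).
  apply: etrans (esym (wirtinger_contract openD (detaW h) (fun i => LB_smooth i j k)
    (fun i => gfund_smooth i r) qD)) _.
  transitivity (deta h (fun x => 2^-1 * (delta_c L k (g j r) x + delta_c L j (g k r) x)) q).
    apply: (eq_wirtinger openD (detaW h) qD) => x /[!inE] xD.
    apply: etrans (LR_g j k r xD); apply: eq_bigr => i _.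
    by apply: (congr1 (fun y => y * _)); exact: H.
  apply: etrans (wirtingerZ openD 2^-1 (detaW h) (smoothD openD (dgs k j) (dgs j k)) qD) _.
  apply: (congr1 ( *%R 2^-1)).
  exact: (wirtingerD openD (detaW h) (dgs k j) (dgs j k) qD).
have d1 := deta_delta_c h k (gfund_smooth j r) qD.
have d2 := deta_delta_c h j (gfund_smooth k r) qD.
have s1 : \sum_(i < n) LB L i k j q * C i r h q = \sum_(i < n) LB L i j k q * C i r h q.
  by apply: eq_bigr => i _; rewrite (LBC i k j qD).
have s2 a b : \sum_(i < n) LB L i h a q * C b r i q = \sum_(i < n) LB L i a h q * C b r i q.
  by apply: eq_bigr => i _; rewrite (LBC i h a qD).
have h2 : 2 * 2^-1 = 1 :> R[i] by rewrite mulfV ?pnatr_eq0.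
(* After multiplication by 2 the product-rule term [S] occurs twice, once as the correction for j in
   the first covariant derivative and once as that for k in the second. The barred corrections [T1]
   and [T2] are the terms subtracted in iii). *)
have lin (A S S' T1 T2 x1 x2 c1 c2 u1 u2 u1' u2' : R[i]) :
    A + S = 2^-1 * (x1 + x2) -> x1 = c1 - u1 -> x2 = c2 - u2 ->
    S' = S -> u1' = u1 -> u2' = u2 ->
    2 * A - T1 - T2 = (c1 - S - T1 - u1') + (c2 - S' - T2 - u2').
  move=> AE x1E x2E -> -> ->.
  have -> : A = 2^-1 * (x1 + x2) - S by rewrite -AE addrK.
  by rewrite x1E x2E; field.
exact: (lin _ _ _ _ _ _ _ _ _ _ _ _ _ E d1 d2 s1 (s2 k j) (s2 j k)).
Qed.

End LandsbergAlgebra.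

Section FinslerCharts.
Context {R : realType} {n : nat} {M : complex_manifold R n} (F : finsler_metric M).
Context (c : chart R n M) (ac : atlas c).
Local Notation D := (slit_dom c).
Local Notation L := (sqr_in_chart F c).

Lemma slit_dom_open : open D.
Proof.
have openV0 : open [set x : 'rV[R[i]]_n | x != 0].
  have -> : [set x : 'rV[R[i]]_n | x != 0] = ~` [set 0].
    by apply/seteqP; split=> x /eqP.
  apply/closed_openC/accessible_closed_set1; apply: hausdorff_accessible.
  exact: norm_hausdorff.
apply: openI.
  apply: (@open_comp _ _ fst); last exact: chart_im_open.
  by move=> x _; exact: cvg_fst.
by apply: open_comp openV0 => x _; exact: cvg_snd.
Qed.

Lemma sqr_in_chart_real q : conjc (L q) = L q.
Proof. exact: conjc_real. Qed.

Lemma sqr_in_chart_hom q (a : R[i]) : D q -> L (q.1, a *: q.2) = `|a| ^+ 2 * L q.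
Proof.
move=> [qD _]; rewrite /sqr_in_chart.
by rewrite !rmorphXn /= (finsler_homog F ac a qD) exprMn.
Qed.

Lemma gmx_unit q : D q -> gmx L q \in unitmx.
Proof.
(* A nonzero left kernel vector would be isotropic for the positive definite Hermitian form. *)
move=> qD; rewrite unitmxE unitfE; apply/negP => /det0P[v v0 vg].
have := finsler_posdef F ac qD v0.
rewrite exchange_big big1 ?ltxx// => j _; rewrite -mulr_suml.
have : (v *m gmx L q) 0 j = 0 by rewrite vg mxE.
rewrite mxE => vgj; rewrite (_ : \sum_(i < n) _ = 0) ?mul0r// -[RHS]vgj.
by apply: eq_bigr => i _; rewrite !mxE mulrC.
Qed.

End FinslerCharts.

Theorem theorem3p1 (R : realType) (n : nat) (M : complex_manifold R n)
    (F : finsler_metric M) :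
  [<-> complex_landsberg F;
       on_slit_bundle F (fun L q => forall l r h : 'I_n,
         \sum_(k < n) hcov3 L (cartan L) l r h k q * q.2 0 k = 0);
       on_slit_bundle F (fun L q => forall j k r h : 'I_n,
         2 * \sum_(i < n) deta h (LB L i j k) q * gfund L i r q
         - \sum_(m < n) LB_bar L m r k q * cartan L j m h q
         - \sum_(m < n) LB_bar L m r j q * cartan L k m h q
         = hcov3 L (cartan L) j r h k q + hcov3 L (cartan L) k r h j q);
       on_slit_bundle F (fun L q => forall i j k : 'I_n,
         hcov2 L (gfund L) i j k q
         = \sum_(m < n) (LR_bar L m j k q - LB_bar L m j k q) * gfund L i m q)].
Proof.
have sm c (ac : atlas c) := finsler_smooth F ac.
have re c (q : 'rV[R[i]]_n * 'rV[R[i]]_n) (qD : slit_dom c q) := sqr_in_chart_real F c q.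
have cartanP c (ac : atlas c) := landsberg_cartan (@slit_dom_open _ _ _ c) (sm c ac)
  (sqr_in_chart_hom F ac) (gmx_unit F ac).
have metricP c (ac : atlas c) := landsberg_metric (@slit_dom_open _ _ _ c) (sm c ac) (re c)
  (gmx_unit F ac).
have symP c (ac : atlas c) := cartan_of_symmetrized (@slit_dom_open _ _ _ c) (sm c ac)
  (sqr_in_chart_hom F ac) (gmx_unit F ac).
have sym c (ac : atlas c) := landsberg_symmetrized (@slit_dom_open _ _ _ c) (sm c ac)
  (gmx_unit F ac).
tfae.
- by move=> H c ac q qD; apply/(cartanP c ac q qD); exact: H.
(* Condition i) is recovered at every point of the chart domain before it is differentiated. *)
- move=> H c ac; apply: (sym c ac) => q qD.
  by apply/(cartanP c ac q qD); exact: H.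
(* From iii) to iv) the path runs through ii) and i), all at the same point. *)
- move=> H c ac q qD; apply/(metricP c ac q qD)/(cartanP c ac q qD).
  exact: (symP c ac q qD (H c ac q qD)).
- by move=> H c ac q qD; apply/(metricP c ac q qD); exact: H.
Qed.
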